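(* Let $H$ be a real Hilbert space and let $\mathcal{E} : H\to\mathbb{R}\cup\{+\infty\}$ be proper, semiconvex and lower semicontinuous. Let $u\in H^1_{loc}(\mathbb{R}_+;H)$ be a global strong solution of the gradient system $$\dot u + \partial\mathcal{E}(u)\ni 0 .$$ Let $\omega(u)$ be the $\omega$-limit set of $u$ taken with respect to the norm topology of $H$, that is, the set of all $\varphi\in H$ for which there exists a sequence $(t_n)\nearrow\infty$ in $\mathbb{R}_+$ with $\lim_{n\to\infty}u(t_n)=\varphi$ in the norm of $H$. Assume that there exist $\varphi\in\omega(u)$ and a $\tau_{\mathcal{E}}$-neighbourhood $U$ of $\varphi$ such that $\mathcal{E}$ satisfies the Kurdyka-Łojasiewicz-Simon inequality on $U$. Then $u$ has finite length in $H$, that is, $\int_0^\infty \|\dot u(t)\|_H\,dt<\infty$, and $\lim_{t\to\infty}u(t)=\varphi$ in $\tau_{\mathcal{E}}$.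
   Context: Here $\mathbb{R}_+=[0,\infty)$, and $H^1_{loc}(\mathbb{R}_+;H)$ is the space of functions whose restriction to $(0,T)$ belongs to $H^1(0,T;H)$ for every $T>0$; such functions are identified with their continuous representatives on $[0,\infty)$. The effective domain of $\mathcal{E}$ is $\mathrm{dom}\,\mathcal{E}=\{v\in H:\mathcal{E}(v)<+\infty\}$; $\mathcal{E}$ is proper if $\mathrm{dom}\,\mathcal{E}\neq\emptyset$. $\mathcal{E}$ is semiconvex if there exists $\omega\in\mathbb{R}$ such that $v\mapsto\mathcal{E}(v)+\frac{\omega}{2}\|v\|_H^2$ is convex. The topology $\tau_{\mathcal{E}}$ on $\mathrm{dom}\,\mathcal{E}$ is the coarsest topology for which both the embedding $\mathrm{dom}\,\mathcal{E}\to H$ (norm topology on $H$) and the map $\mathcal{E}:\mathrm{dom}\,\mathcal{E}\to\mathbb{R}$ are continuous. Thus a net $(u_\alpha)$ in $\mathrm{dom}\,\mathcal{E}$ converges to $v\in\mathrm{dom}\,\mathcal{E}$ in $\tau_{\mathcal{E}}$ if and only if $\|u_\alpha-v\|_H\to0$ and $\mathcal{E}(u_\alpha)\to\mathcal{E}(v)$. A $\tau_{\mathcal{E}}$-neighbourhood of $\varphi$ is a neighbourhood of $\varphi$ in the topological space $(\mathrm{dom}\,\mathcal{E},\tau_{\mathcal{E}})$ (so in particular $\varphi\in\mathrm{dom}\,\mathcal{E}$). For any function $\mathcal{F}:H\to\mathbb{R}\cup\{+\infty\}$ the subgradient is the relation $$\partial\mathcal{F}:=\Big\{(v,f)\in H\times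 H: v\in\mathrm{dom}\,\mathcal{F}\text{ and for every }w\in H,\ \liminf_{\lambda\to0+}\frac{\mathcal{F}(v+\lambda w)-\mathcal{F}(v)}{\lambda}\ge\langle f,w\rangle_H\Big\},$$ $\partial\mathcal{F}(v):=\{f\in H:(v,f)\in\partial\mathcal{F}\}$, and the slope is $|\partial\mathcal{F}(v)|:=\inf\{\|f\|_H:f\in\partial\mathcal{F}(v)\}$ with $\inf\emptyset=\infty$. A function $u\in H^1_{loc}(\mathbb{R}_+;H)$ is a strong solution of $\dot u+\partial\mathcal{E}(u)\ni0$ if $(u(t),-\dot u(t))\in\partial\mathcal{E}$ for almost every $t\in\mathbb{R}_+$. $\mathcal{E}$ satisfies the Kurdyka-Łojasiewicz-Simon inequality on a set $U\subseteq H$ if there exists a strictly increasing $\Theta\in W^{1,1}_{loc}(\mathbb{R})$ (identified with its continuous representative) such that $|\partial(\Theta\circ\mathcal{E})(v)|\ge1$ for every $v\in U$ with $0\notin\partial\mathcal{E}(v)$. Here $(\Theta\circ\mathcal{E})(v)=+\infty$ whenever $\mathcal{E}(v)=+\infty$. *)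

(* Defs.v *)
From HB Require Import structures.
From mathcomp Require Import all_boot all_order all_algebra sesquilinear.
From mathcomp Require Import all_classical all_reals all_analysis.

Set Implicit Arguments.
Unset Strict Implicit.
Unset Printing Implicit Defensive.

Import Order.TTheory GRing.Theory Num.Theory.
Import numFieldNormedType.Exports.

Local Open Scope classical_set_scope.
Local Open Scope ring_scope.

(** * Bochner integral and Sobolev spaces of vector-valued functions *)

Section Bochner.
Context (R : realType) (X : normedModType R).
Implicit Types (D : set R) (f g : R -> X) (s : {fimfun R >-> X}).

Definition measurable_simple D s :=
  forall x, measurable (D `&` s @^-1` [set x]).

Definition integrable_simple D s := measurable_simple D s /\
  forall x, x != 0 -> (lebesgue_measure (D `&` s @^-1` [set x]) < +oo)%E.

(* The value 0 may be taken on a set of infinite measure: [fine +oo = 0], and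
   the term vanishes anyway. *)
Definition simple_integral D s : X :=
  \sum_(x \in range s) fine (lebesgue_measure (D `&` s @^-1` [set x])) *: x.

Definition strongly_measurable D f :=
  exists s : nat -> {fimfun R >-> X}, (forall n, measurable_simple D (s n)) /\
    {ae lebesgue_measure, forall t, D t -> s n t @[n --> \oo] --> f t}.

(* [f] is Bochner integrable on [D] with integral [v].
   Strong measurability only makes the functions [`|f t - s n t|] Lebesgue
   measurable, not Borel measurable.  On nonnegative functions the library
   integral is the supremum of the integrals of Borel simple functions below,
   which is the usual integral for Lebesgue measurable functions; the same
   applies to the integrals of norms in the rest of this file. *)
Definition has_bochner_integral D f (v : X) := strongly_measurable D f /\
  exists s : nat -> {fimfun R >-> X},
    [/\ forall n, integrable_simple D (s n),
        (\int[lebesgue_measure]_(t in D) `|f t - s n t|%:E)%E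
          @[n --> \oo] --> 0%E &
        simple_integral D (s n) @[n --> \oo] --> v].

Definition memLp (p : nat) D f := strongly_measurable D f /\
  (\int[lebesgue_measure]_(t in D) (`|f t| ^+ p)%:E < +oo)%E.

Definition test_function (I : set R) (phi : R -> R^o) :=
  (forall n x, derivable (derive1n n phi) x 1) /\
  exists K, [/\ compact K, K `<=` I & forall x, ~ K x -> phi x = 0].

Definition weak_derivative (I : set R) f g := forall phi, test_function I phi ->
  exists v, has_bochner_integral I (fun t => derive1 phi t *: f t) v /\
            has_bochner_integral I (fun t => phi t *: g t) (- v).

(* [f] is in W^{1,p}(I; X), with (a representative of its) derivative [g]. *)
Definition sobolev1 (p : nat) (I : set R) f g :=
  [/\ memLp p I f, memLp p I g & weak_derivative I f g].

End Bochner.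

(* [u] is (the continuous representative of) an element of
   H^1_loc([0, +oo[; X), with derivative [du]. *)
Definition H1loc (R : realType) (X : normedModType R) (u du : R -> X) :=
  {within `[0, +oo[, continuous u} /\
  forall T : R, 0 < T -> sobolev1 2 `]0, T[ u du.

(* [Theta] is (the continuous representative of) an element of W^{1,1}_loc(R). *)
Definition W11loc (R : realType) (Theta : R -> R) :=
  continuous Theta /\
  exists dTheta : R -> R^o, forall a b : R, a < b ->
    sobolev1 1 `]a, b[ (Theta : R -> R^o) dTheta.

(** * Functionals with values in R ∪ {+oo} *)

Section Functional.
Context (R : realType) (H : normedModType R).
Implicit Types (F E : H -> \bar R) (v w f : H).

Definition dom F : set H := [set v | (F v < +oo)%E].

Definition proper_functional F := (forall v, F v != -oo%E) /\ dom F !=set0.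

Definition convex_functional F := forall v w (t : R), 0 <= t <= 1 ->
  (F (t *: v + (1 - t) *: w)%R <= t%:E * F v + (1 - t)%:E * F w)%E.

Definition semiconvex E := exists omega : R,
  convex_functional (fun v => E v + (omega / 2 * `|v| ^+ 2)%:E)%E.

(* The coarsest topology on [dom E] for which both the embedding in [H] and
   [E : dom E -> R] are continuous: the initial topology of these two maps. *)
Definition tau E : topologicalType := initial_topology
  (fun v : dom E => (set_val v, fine (E (set_val v))) : H * R^o).

Definition tau_val E (v : tau E) : H := set_val (v : dom E).

(* [u t] tends to [phi] in [tau E] as [t] tends to +oo; in particular [u t]
   belongs to [dom E] for all large [t]. *)
Definition tau_cvg E (u : R -> H) (phi : tau E) :=
  forall V : set (tau E), nbhs phi V ->
    \forall t \near +oo, (@tau_val E @` V) (u t).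

Definition omega_limit (u : R -> H) : set H := [set phi | exists t : nat -> R,
  [/\ forall n, 0 <= t n, nondecreasing_seq t, t n @[n --> \oo] --> +oo &
      u (t n) @[n --> \oo] --> phi]].

Variable dot : H -> H -> R.

Definition subgradient F v : set H := [set f | dom F v /\ forall w,
  ((dot f w)%:E <= limf_einf (fun l : R => (F (v + l *: w)%R - F v) * l^-1%:E)
                             (0 : R)^'+)%E].

Definition slope F v : \bar R := ereal_inf [set `|f|%:E | f in subgradient F v].

(* [er_map Theta] extends [Theta] by the value [+oo] at [+oo]. *)
Definition KLS_inequality E (U : set H) := exists Theta : R -> R,
  [/\ {homo Theta : x y / x < y}, W11loc Theta &
      forall v, U v -> ~ subgradient E v 0 ->
        (1 <= slope (er_map Theta \o E) v)%E].

(* [u], with derivative [du], is a strong solution on [0, +oo[ of the gradient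
   system of [E]. *)
Definition strong_solution E (u du : R -> H) := H1loc u du /\
  {ae lebesgue_measure, forall t : R, 0 <= t -> subgradient E (u t) (- du t)}.

End Functional.

(* Main.v *)
Require Import Defs.
From HB Require Import structures.
From mathcomp Require Import all_boot all_order all_algebra sesquilinear.
From mathcomp Require Import all_classical all_reals all_analysis.
From mathcomp Require Import measurable_realfun.
From mathcomp Require Import ring lra.

Set Implicit Arguments.
Unset Strict Implicit.
Unset Printing Implicit Defensive.

Import Order.TTheory GRing.Theory Num.Theory.
Import numFieldNormedType.Exports.

Local Open Scope classical_set_scope.
Local Open Scope ring_scope.

(** Formally, a solution of [u' + dE(u) = 0] satisfies [(E o u)' = - |u'|^2], and
    the Kurdyka-Lojasiewicz-Simon inequality says [Theta'(E(u)) |u'| >= 1] as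
    long as [u] stays in the given neighbourhood of [phi].  Hence
    [- (Theta o E o u)' = Theta'(E(u)) |u'|^2 >= |u'|]: the length of [u] over a
    time interval spent in that neighbourhood is at most the drop of
    [Theta (E (u t))] over this interval.  Since [E (u t)] decreases to
    [E phi], this drop is arbitrarily small from a late time [t_n] on with
    [u t_n] close to [phi]; therefore [u] can never leave the neighbourhood
    again, its remaining length is finite, and it converges
    ([flow_converges]).

    The chain rules are replaced by a single inequality: for a nonincreasing
    function [G], the integral of a lower bound of the backward difference
    quotients is at most the total drop of [G] ([nonincreasing_integral_le]).
    It follows from the Fatou lemma and the translation invariance of the
    integral, and it holds for functions [G] that are not absolutely
    continuous.  It is applied to [E o u] minus a linear function
    ([energy_inequality]), to [Theta o E o u] ([length_le]), and to some
    auxiliary functions.  Only the behaviour of [u] at almost every time is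
    needed; it comes from the following facts.

    A weak derivative of [u] is turned into increments of [<u, w>] by testing
    with smooth approximations of indicator functions
    ([weak_derivative_Rintegral], [weak_derivative_functional]).  As the
    derivative is almost everywhere equal to a function [g] with separable
    range whose composites with continuous functions are Borel
    ([borel_representative]), almost every time is a Lebesgue point of [g], and [u' = g] there in the
    norm ([ae_is_derive]).

    Semiconvexity makes [E] lie above paraboloids of a fixed opening given by
    its subgradients ([semiconvex_subgradient_le]), and thus [dE + 2K] is a
    monotone relation.  Consequently [|u (t + e) - u t|] grows at most like
    [exp (2Kt)] ([increment_contraction]), [u] is locally Lipschitz on
    [(0, oo)], and the paraboloids bound the difference quotients of [E o u];
    lower semicontinuity extends these bounds from almost every time to all
    times ([energy_upper]).

    The limit of [E (u t)] is at least [E phi] by lower semicontinuity.  It is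
    at most [E phi] because close to [t_n] there are times at which the slope
    [|u'|] is small, and there the paraboloid below [E] controls [E (u t)] by
    [E phi] ([energy_limit_ge]).

    Finally, [Theta] is differentiable outside a null set [N] only.  The times
    with [E (u t)] in [N] may have positive measure, but [u' = 0] at almost all
    of them ([ae_energy_notin_null]), and they do not contribute to the length.
    At the other times [Theta'(E v)] times a subgradient of [E] at [v] is a
    subgradient of [Theta o E] ([subgradient_er_map]), which is how the
    hypothesis on the slope of [Theta o E] is used. *)

Local Notation mu := lebesgue_measure.

(** * Integrals and difference quotients of monotone functions *)

Lemma preimage_shift_itv (R : realType) (c a b : R) ba bb :
  (fun x => x + c) @^-1` [set` Interval (BSide ba a) (BSide bb b)] =
  [set` Interval (BSide ba (a - c)) (BSide bb (b - c))].
Proof.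
by apply/seteqP; split=> x /=; rewrite !in_itv /=;
  case: ba; case: bb => /= /andP[? ?]; apply/andP; split; lra.
Qed.

Lemma measurable_shift (R : realType) (c : R) :
  measurable_fun setT ((fun x => x + c) : R -> measurableTypeR R).
Proof. by apply: measurable_funD => //; exact: measurable_cst. Qed.

Lemma lebesgue_measure_shift (R : realType) (c : R) (A : set R) : measurable A ->
  pushforward mu ((fun x => x + c) : R -> measurableTypeR R) A = mu A.
Proof.
move=> mA; apply/esym/lebesgue_measure_unique => //.
  exact: measurable_shift.
move=> ? _ [[a b]] _ <-.
rewrite /pushforward [X in _ = mu X](_ : _ = `](a - c), (b - c)]%classic);
  last exact: preimage_shift_itv.
rewrite !lebesgue_measure_itv/=.
rewrite !lte_fin ltrD2r; case: ifP => // _.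
by rewrite -!EFinB; congr EFin; ring.
Qed.

Lemma ge0_integral_shift (R : realType) (c : R) (D : set R) (f : R -> \bar R) :
  measurable D -> measurable_fun D f -> (forall x, D x -> 0 <= f x)%E ->
  (\int[mu]_(x in (fun x => (x + c)%R) @^-1` D) f (x + c)%R =
   \int[mu]_(x in D) f x)%E.
Proof.
move=> mD mf f0.
rewrite -(@ge0_integral_pushforward _ _ (measurableTypeR R) (measurableTypeR R) R
  (fun x : R => x + c) (measurable_shift c) mu D f)//; last first.
  by move=> y; rewrite inE; exact: f0.
by apply: eq_measure_integral => [|? A mA AS]; [exact: measurable_shift|exact: lebesgue_measure_shift].
Qed.

Import HBNNSimple.

(** The integral of a nonnegative function is a supremum over the simple
    functions below it, hence monotone on arbitrary functions.  This matters
    because norms of strongly measurable functions are Borel only up to a null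
    set. *)
Lemma le_nonneg_integral (R : realType) (D : set R) (f g : R -> \bar R) :
  (forall x, D x -> 0 <= f x)%E -> (forall x, D x -> f x <= g x)%E ->
  (\int[mu]_(x in D) f x <= \int[mu]_(x in D) g x)%E.
Proof.
move=> f0 fg; have g0 x : D x -> (0 <= g x)%E.
  by move=> Dx; exact: le_trans (f0 _ Dx) (fg _ Dx).
rewrite !ge0_integralE//; apply: le_ereal_sup => _ [h /= hf <-].
exists h => //= x; apply: (le_trans (hf x)).
by apply: lee_restrict.
Qed.

(** By translation invariance, the integral over [`]a, b[] of the backward
    quotient with step [e] telescopes to [1/e] times the difference of two
    integrals of [G] over intervals of length [e], at the two ends, and this is at most
    [G a - G b].  The Fatou lemma lets [e] tend to [0]. *)
Lemma nonincreasing_integral_le (R : realType) (G f : R -> R) (a b : R) : a <= b ->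
  (forall x y, a <= x -> x <= y -> y <= b -> G y <= G x) ->
  measurable_fun `]a, b[ f -> (forall x, a < x < b -> 0 <= f x) ->
  {ae mu, forall r, a < r < b -> forall e, 0 < e ->
    \forall n \near \oo, f r - e <= n.+1%:R * (G (r - n.+1%:R^-1) - G r)} ->
  (\int[mu]_(r in `]a, b[) (f r)%:E <= (G a - G b)%:E)%E.
Proof.
move=> ab Gni mf f0 aef.
(* [K] extends [G - G b] by constants outside of [a, b], so that it can be
   translated and remains nonincreasing. *)
pose c x := Num.max a (Num.min x b).
pose K x := G (c x) - G b; pose M := G a - G b.
have cab x : a <= c x <= b by rewrite /c le_max lexx/= ge_max ab ge_min lexx orbT.
have cnd : {homo c : x y / x <= y}.
  move=> x y xy; rewrite /c ge_max le_max lexx /=.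
  by rewrite le_max; apply/orP; right; rewrite le_min !ge_min xy lexx !orbT.
have Kni : nonincreasing_fun K.
  move=> x y xy; rewrite /K lerD2r.
  by move: (cab x) (cab y) => /andP[? ?] /andP[? ?]; apply: Gni => //; exact: cnd.
have K0 x : 0 <= K x.
  by rewrite /K subr_ge0; move: (cab x) => /andP[? ?]; apply: Gni.
have KM x : K x <= M.
  by rewrite /K /M lerD2r; move: (cab x) => /andP[? ?]; apply: Gni.
have mK : measurable_fun setT K by exact: nonincreasing_measurable.
pose eps n : R := n.+1%:R^-1.
have eps0 n : 0 < eps n by rewrite invr_gt0.
pose q n x := n.+1%:R * (K (x - eps n) - K x).
have q0 n x : 0 <= q n x.
  by rewrite mulr_ge0// subr_ge0; apply: Kni; rewrite lerBlDr lerDl ltW.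
have mKs (e : R) : measurable_fun setT (fun x : R => K (x + e)).
  exact: (measurableT_comp mK (measurable_shift e)).
have mq n : measurable_fun setT (q n).
  apply: measurable_funM => //; apply: measurable_funB => //; exact: mKs.
pose D : set R := `]a, b[%classic.
have mD : measurable D by exact: measurable_itv.
have muD : mu D = (b - a)%:E.
  rewrite /D lebesgue_measure_itv/= lte_fin; case: ltP => // ba.
  by rewrite (@le_anti _ _ a b) ?ab// subrr.
have muDoo : (mu D < +oo)%E by rewrite muD ltry.
have Dab (x : R) : D x -> a < x < b by rewrite /D/= in_itv.
have mDE (D' : set R) (h : R -> R) : measurable_fun setT h -> measurable_fun D' (fun x => (h x)%:E).
  by move=> mh; apply/measurable_EFinP; exact: measurable_funTS.
have intq n : (\int[mu]_(x in D) (q n x)%:E <= M%:E)%E.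
  have intK : (\int[mu]_(x in D) (K x)%:E)%E \is a fin_num.
    apply: integrable_fin_num => //.
    apply: measurable_bounded_integrable => //.
    - exact: measurable_funTS.
    - exists M; split; first exact: num_real.
      by move=> x Mx y _; rewrite /= ger0_norm//; apply: (le_trans (KM y)); exact: ltW.
  have E1 : (\int[mu]_(x in D) (K (x - eps n))%:E =
      \int[mu]_(x in D) (K x)%:E + (eps n)%:E * \int[mu]_(x in D) (q n x)%:E)%E.
    rewrite -ge0_integralZl//; do ?[exact: mDE| by rewrite lee_fin ltW];
      last by move=> x _; rewrite lee_fin.
    rewrite -ge0_integralD//; do ?[exact: mDE | by move=> x _; rewrite ?mule_ge0// lee_fin// ltW];
      last by apply: measurable_funeM; exact: mDE.
    apply: eq_integral => x _; rewrite -EFinM -EFinD; congr EFin.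
    by rewrite /q {2}/eps mulrA mulVf ?pnatr_eq0// mul1r; ring.
  (* The translated interval sticks out of [`]a, b[] on the left by [eps n],
     where [K] is at most [M]. *)
  have E2 : (\int[mu]_(x in D) (K (x - eps n))%:E <=
      \int[mu]_(x in D) (K x)%:E + (eps n)%:E * M%:E)%E.
    have DE : D = (fun x => x - eps n) @^-1` `]a - eps n, b - eps n[.
      by rewrite preimage_shift_itv !opprK !subrK.
    have -> : (\int[mu]_(x in D) (K (x - eps n))%:E =
        \int[mu]_(x in `](a - eps n)%R, (b - eps n)%R[) (K x)%:E)%E.
      rewrite DE (@ge0_integral_shift _ _ _ (EFin \o K))//=; first exact: mDE.
      by move=> x _; rewrite lee_fin.
    apply: (@le_trans _ _ (\int[mu]_(x in D `|` `](a - eps n)%R, a]) (K x)%:E))%E.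
      apply: ge0_subset_integral => //.
      - exact: measurableU.
      - exact: mDE.
      - by move=> x _; rewrite lee_fin.
      move=> x /=; rewrite /D /= !in_itv /= => /andP[ax xb].
      have [xa|xa] := leP x a; first by right; rewrite ax.
      by left; rewrite (lt_le_trans xb)// lerBlDr lerDl ltW.
    rewrite ge0_integral_setU//=; last 3 first.
      exact: mDE.
      by move=> x _; rewrite lee_fin.
      apply/disj_setPS => x /= []; rewrite /D /= !in_itv /= => /andP[ax _] /andP[_].
      by rewrite leNgt ax.
    apply: leeD => //.
    apply: (@le_trans _ _ (\int[mu]_(x in `](a - eps n)%R, a]) (cst M%:E x)))%E.
       by apply: le_nonneg_integral => x _; rewrite lee_fin.
    rewrite integral_cst//= lebesgue_measure_itv/= lte_fin ltrBlDr ltrDl eps0.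
    by rewrite -EFinB opprB addrC subrK muleC.
  move: E2; rewrite E1 leeD2lE// lee_pmul2l// ?lte_fin//.
apply: (@le_trans _ _ (\int[mu]_(x in D) limn_einf (fun n => (q n x)%:E)))%E.
  apply: ae_ge0_le_integral => //.
  - exact/measurable_EFinP.
  - move=> x _; rewrite limn_einf_lim.
    apply: lime_ge; first exact: is_cvg_einfs.
    near=> n; apply: le_ereal_inf_tmp => _ [m /= _ <-]; by rewrite lee_fin.
  - rewrite /limn_einf /limf_einf.
    apply: measurableT_comp => //.
    apply: measurable_fun_limn_esup => n.
    apply: measurableT_comp => //.
    exact: mDE.
  move: aef; apply: filterS; first exact: (ae_filter_ringOfSetsType mu).
  move=> r fr /Dab rab.
  have {}fr := fr rab.
  apply/lee_subgt0Pr => e e0.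
  rewrite limn_einf_lim; apply: lime_ge; first exact: is_cvg_einfs.
  have [N _ HN] := fr _ e0.
  have [ar rb] := andP rab.
  have [N2 _ HN2] : \forall n \near \oo, eps n <= r - a.
    have := @cvgr_le _ _ _ _ _ _ (@cvg_harmonic R) (r - a).
    by apply; rewrite subr_gt0.
  exists (maxn N N2) => // n /= Nn; apply: le_ereal_inf_tmp => _ [m /= nm <-].
  rewrite -EFinB lee_fin; apply: (le_trans (HN m _)).
    by rewrite /= (leq_trans _ nm)// (leq_trans _ Nn)// leq_maxl.
  have em : eps m <= r - a by apply: HN2; rewrite /= (leq_trans _ nm)// (leq_trans _ Nn)// leq_maxr.
  rewrite /q ler_wpM2l//.
  have cE x : a <= x <= b -> c x = x.
    by move=> /andP[ax xb]; rewrite /c (min_idPl xb) (max_idPr ax).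
  rewrite /K !cE; last 2 first.
    by rewrite !ltW.
    apply/andP; split; first by rewrite lerBrDr addrC -lerBrDr.
    by rewrite (le_trans _ (ltW rb))// lerBlDr lerDl ltW.
  by rewrite -/(eps m); lra.
apply: (le_trans (fatou _ _ _ _)) => //.
- by move=> n; exact: mDE.
- by move=> n x _; rewrite lee_fin.
rewrite limn_einf_lim; apply: lime_le; first exact: is_cvg_einfs.
near=> n; apply: ereal_inf_le; exists (\int[mu]_(x in D) (q n x)%:E)%E => //.
by exists n => /=.
Unshelve. all: by end_near. Qed.

(** * Smooth steps *)

(** Derivatives are carried as functions, so that closure under the algebraic
    operations is an induction on the order. *)
Fixpoint nsmooth (R : realType) (n : nat) (f : R -> R) : Prop :=
  if n is n'.+1 then
    exists2 f' : R -> R, (forall x : R, is_derive x 1 f (f' x)) & nsmooth n' f'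
  else True.

Lemma nsmooth_derivable (R : realType) n (f : R -> R) : nsmooth n.+1 f ->
  forall x, derivable (derive1n n (f : R -> R^o)) x 1.
Proof.
elim: n f => [f [f' df _] x|n IH f [f' df f'n] x].
  by have [] := df x.
rewrite derive1Sn.
have -> : ((f : R -> R^o)^`())%classic = f'.
  by apply/funext => y; rewrite derive1E; exact: (@derive_val _ _ _ _ _ _ _ (df y)).
exact: IH.
Qed.

Lemma nsmoothW (R : realType) n (f : R -> R) : nsmooth n.+1 f -> nsmooth n f.
Proof.
elim: n f => // n IH f [f' df f'n]; exists f' => //; exact: IH.
Qed.

Lemma nsmooth_cst (R : realType) n (c : R) : nsmooth n (cst c).
Proof.
elim: n c => //= n IH c; exists (cst 0) => // x; exact: is_derive_cst.
Qed.

Lemma nsmoothD (R : realType) n (f g : R -> R) : nsmooth n f -> nsmooth n g ->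
  nsmooth n (fun x => f x + g x).
Proof.
elim: n f g => //= n IH f g [f' df f'n] [g' dg g'n].
exists (fun x => f' x + g' x); last exact: IH.
by move=> x; have := df x; have := dg x => *; exact: is_deriveD.
Qed.

Lemma nsmoothM (R : realType) n (f g : R -> R) : nsmooth n f -> nsmooth n g ->
  nsmooth n (fun x => f x * g x).
Proof.
elim: n f g => //= n IH f g [f' df f'n] [g' dg g'n].
exists (fun x => f x * g' x + g x * f' x).
  by move=> x; have := df x; have := dg x => *; exact: is_deriveM.
apply: nsmoothD; apply: IH => //.
- by apply: nsmoothW; exists f'.
- by apply: nsmoothW; exists g'.
Qed.

Lemma nsmoothV (R : realType) n (f : R -> R) : (forall x, f x != 0) ->
  nsmooth n f -> nsmooth n (fun x => (f x)^-1).
Proof.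
move=> f0; elim: n => //= n IH [f' df f'n].
exists (fun x => (- 1) * ((f x)^-1 * (f x)^-1) * f' x).
  move=> x; have := df x => dfx; apply: (is_derive_eq (is_deriveV (f0 x) dfx)).
  by rewrite /GRing.scale/= expr2 invfM mulN1r.
have Vn : nsmooth n (fun x => (f x)^-1).
  by apply: IH; apply: nsmoothW; exists f'.
by apply: nsmoothM => //; apply: nsmoothM; [exact: nsmooth_cst|exact: nsmoothM].
Qed.

Lemma nsmooth_affine (R : realType) n (f : R -> R) (a b : R) : nsmooth n f ->
  nsmooth n (fun x => f (a * x + b)).
Proof.
elim: n f => //= n IH f [f' df f'n].
exists (fun x => f' (a * x + b) * a); last first.
  by apply: nsmoothM; [exact: IH|exact: nsmooth_cst].
move=> x; apply: (@is_derive1_comp _ f (fun y => a * y + b)).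
have -> : (fun y => a * y + b) = (a *: id + cst b) by [].
by apply: is_derive_eq; rewrite /GRing.scale/= addr0 mulr1.
Qed.

(** [x^(-k) exp (-1/x)], extended by [0]: this family is closed under
    differentiation up to linear combinations. *)
Definition expinv (R : realType) (k : nat) (x : R) : R :=
  if 0 < x then x^-1 ^+ k * expR (- x^-1) else 0.

Lemma expinv_ge0 (R : realType) k (x : R) : 0 <= expinv k x.
Proof.
rewrite /expinv; case: ifP => // x0.
by rewrite mulr_ge0 ?expR_ge0// exprn_ge0// invr_ge0 ltW.
Qed.

(** [exp y] dominates [y^(k+2) / (k+2)!] for [y = 1/x]; a quadratic bound is
    what differentiability at [0] needs. *)
Lemma expinv_le (R : realType) k (x : R) : expinv k x <= (k.+2)`!%:R * x ^+ 2.
Proof.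
rewrite /expinv; case: ifPn => x0; last by rewrite mulr_ge0// sqr_ge0.
rewrite expRN.
have y0 : 0 < x^-1 by rewrite invr_gt0.
have := expR_ge1Dxn k.+1 (ltW y0).
set y := x^-1 in y0 *; set E := expR y => yE.
have E0 : 0 < E by exact: expR_gt0.
have yE' : y ^+ k.+2 <= (k.+2)`!%:R * E.
  rewrite mulrC -ler_pdivrMr ?ltr0n ?fact_gt0//.
  by apply: le_trans yE; rewrite lerDr.
have -> : x ^+ 2 = (y ^+ 2)^-1 by rewrite /y exprVn invrK.
rewrite ler_pdivrMr// mulrAC ler_pdivlMr ?exprn_gt0//.
by rewrite -exprD addn2.
Qed.

Lemma is_derive_expinv (R : realType) k (x : R) :
  is_derive x 1 (expinv k) (expinv k.+2 x - k%:R * expinv k.+1 x).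
Proof.
have [x0|x0|->] := ltgtP x 0.
- rewrite /expinv !ltNge ltW//= mulr0 subr0.
  apply: (@near_eq_is_derive _ _ _ (cst 0)).
  near=> y; rewrite ltNge ltW//=; near: y; exact: lt_nbhsl.
- have xn0 : x != 0 by rewrite gt_eqF.
  have dV : is_derive x 1 (fun y : R => y^-1) (- x ^- 2).
    apply: (is_derive_eq (@is_deriveV _ id _ _ _ xn0 (is_derive_id _ _))).
    by rewrite /GRing.scale/= mulr1.
  have dE : is_derive x 1 (fun y : R => expR (- y^-1)) (expR (- x^-1) * x ^- 2).
    apply: (@is_derive1_comp _ expR (fun y => - y^-1)).
    by apply: is_derive_eq; rewrite opprK.
  have dX : is_derive x 1 (fun y : R => y^-1 ^+ k) ((k%:R * x^-1 ^+ k.-1) *: (- x ^- 2)).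
    have -> : (fun y : R => y^-1 ^+ k) = ((fun y : R => y^-1) ^+ k).
      by apply/funext => y; rewrite exprfctE.
    exact: is_deriveX.
  have D := is_deriveM dX dE.
  apply: (near_eq_is_derive _ (is_derive_eq D _)).
    near=> y; rewrite /expinv ifT//; near: y; exact: (lt_nbhsr x0).
  rewrite /expinv x0 /GRing.scale/= -!exprVn.
  case: k {dX D} => [|k]/=; first by rewrite !expr0 !mul0r !mulr0 addr0 subr0 mul1r mulrC.
  by rewrite !exprS; ring.
- rewrite [expinv _.+2 _]/expinv [expinv _.+1 _]/expinv ltxx mulr0 subrr.
  have D0 : h^-1 *: (expinv k (h *: 1 + 0) - expinv k 0) @[h --> (0:R)^'] --> (0 : R).
    apply/cvgrPdist_le => e e0; near=> h.
    have h0 : h != 0 by near: h; exact: nbhs_dnbhs_neq.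
    rewrite sub0r normrN addr0 /GRing.scale/= mulr1.
    rewrite [expinv k 0]/expinv ltxx subr0 normrM normfV (ger0_norm (expinv_ge0 _ _)).
    rewrite ler_pdivrMl ?normr_gt0//; apply: (le_trans (expinv_le _ _)).
    rewrite -normr_gt0 in h0; rewrite -real_normK ?num_real// expr2 mulrA mulrC ler_pM2l//.
    rewrite -ler_pdivlMl ?ltr0n ?fact_gt0//.
    by near: h; apply: dnbhs0_le; rewrite mulr_gt0// invr_gt0 ltr0n fact_gt0.
  by apply: DeriveDef; [apply/cvg_ex; exists 0|apply/cvg_lim].
Unshelve. all: by end_near. Qed.

Lemma nsmooth_expinv (R : realType) n k : nsmooth n (@expinv R k).
Proof.
elim: n k => //= n IH k; exists (fun x => expinv k.+2 x + (- k%:R) * expinv k.+1 x).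
  by move=> x; have := is_derive_expinv k x; rewrite mulNr.
by apply: nsmoothD => //; apply: nsmoothM => //; exact: nsmooth_cst.
Qed.

Lemma smooth_step (R : realType) : exists S S' : R -> R,
  [/\ forall n, nsmooth n S, forall x : R, is_derive x 1 S (S' x),
      forall x, 0 <= S x <= 1,
      (forall x, x <= 0 -> S x = 0) /\ (forall x, 1 <= x -> S x = 1) &
      [/\ continuous S', forall x, 0 <= S' x & forall x, ~~ (0 < x < 1) -> S' x = 0]].
Proof.
(* [a x / (a x + a (1 - x))] where [a x = exp (-1/x)] for positive [x]: the two
   summands never vanish simultaneously. *)
pose a : R -> R := expinv 0; pose b := fun x => a (1 - x).
have a0 x : 0 < x -> 0 < a x.
  by move=> x0; rewrite /a /expinv x0 expr0 mul1r expR_gt0.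
have a0' x : x <= 0 -> a x = 0 by rewrite /a /expinv ltNge => ->.
have age x : 0 <= a x by exact: expinv_ge0.
have ab0 x : 0 < a x + b x.
  have [x0|x0] := ltP 0 x; first by apply: ltr_pwDl; [exact: a0|exact: age].
  by apply: ltr_wpDl; [exact: age|rewrite /b a0// subr_gt0 (le_lt_trans x0)].
have abn0 x : a x + b x != 0 by rewrite gt_eqF.
have sa n : nsmooth n a by exact: nsmooth_expinv.
have sb n : nsmooth n b.
  have -> : b = (fun x => a ((-1) * x + 1)).
    by apply/funext => x; rewrite /b mulN1r addrC.
  exact: nsmooth_affine.
have da (x : R) : is_derive x 1 a (expinv 2 x).
  by apply: (is_derive_eq (is_derive_expinv 0 x)); rewrite mul0r subr0.
have db (x : R) : is_derive x 1 b (- expinv 2 (1 - x)).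
  rewrite -mulrN1; apply: (@is_derive1_comp _ a (fun y => 1 - y)).
  by apply: is_derive_eq; rewrite add0r mul1r.
pose S x := a x * (a x + b x)^-1.
pose S' x := (expinv 2 x * b x + a x * expinv 2 (1 - x)) / (a x + b x) ^+ 2.
have sS n : nsmooth n S.
  by apply: nsmoothM => //; apply: nsmoothV => //; exact: nsmoothD.
have dS (x : R) : is_derive x 1 S (S' x).
  have dab := @is_deriveV _ (a + b) _ _ _ (abn0 x) (is_deriveD (da x) (db x)).
  apply: (is_derive_eq (is_deriveM (da x) dab)).
  rewrite /S' /GRing.scale/= -[(a + b) x]/(a x + b x); have := abn0 x.
  by move=> ?; field.
exists S, S'; rewrite /S; split=> //.
- move=> x; rewrite mulr_ge0 ?invr_ge0 ?(ltW (ab0 x))//=.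
  by rewrite ler_pdivrMr// mul1r lerDl age.
- split; first by move=> x x0; rewrite a0'// mul0r.
  move=> x x1; rewrite /b (a0' (1 - x)) ?subr_le0// addr0 divff// gt_eqF//.
  by rewrite a0// (lt_le_trans _ x1).
- split.
  + have [T dT [T' dT' _]] := sS 2%N.
    have -> : S' = T.
      apply/funext => x; rewrite -(@derive_val _ _ _ _ _ _ _ (dS x)).
      by rewrite -(@derive_val _ _ _ _ _ _ _ (dT x)).
    move=> x; apply: differentiable_continuous; apply/derivable1_diffP.
    by have [] := dT' x.
  + move=> x; rewrite mulr_ge0 ?invr_ge0 ?sqr_ge0// addr_ge0// mulr_ge0 ?age//;
    exact: expinv_ge0.
  + move=> x; rewrite negb_and -!leNgt => /orP[x0|x1].
      by rewrite /S' a0'// mul0r addr0 /expinv ltNge x0 mul0r mul0r.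
    rewrite /S' /b a0' ?subr_le0// mulr0 add0r /expinv subr_gt0 ltNge x1/=.
    by rewrite mulr0 mul0r.
Qed.

(** * From weak derivatives to integrals *)

Lemma restrict_subset (U : Type) (R : realType) (D1 D2 : set U) (f : U -> R) :
  D1 `<=` D2 -> (forall x, ~ D1 x -> f x = 0) -> f \_ D2 = f \_ D1.
Proof.
move=> D12 f0; apply/funext => x; rewrite !patchE.
have [xD1|xD1] := pselect (D1 x); first by rewrite !mem_set//; exact: D12.
by rewrite (memNset xD1) (f0 _ xD1); case: ifP.
Qed.

(** The derivative of the step [S (N (x - s))] is a probability density
    supported in [`[s, s + 1/N]], so integrating against it averages [f] near
    [s]. *)
Lemma Rintegral_kernel (R : realType) (S S' f : R -> R) (a b s N e : R) :
  (forall x : R, is_derive x 1 S (S' x)) -> continuous S' ->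
  (forall x, 0 <= S' x) -> (forall x, ~~ (0 < x < 1) -> S' x = 0) ->
  S 0 = 0 -> S 1 = 1 ->
  0 < N -> a < s -> s + N^-1 < b ->
  {in `]a, b[, continuous f} ->
  (forall x, s <= x <= s + N^-1 -> `|f x - f s| <= e) ->
  mu.-integrable `]a, b[ (EFin \o (fun x => N * S' (N * (x - s)) * f x)) /\
  `|\int[mu]_(x in `]a, b[) (N * S' (N * (x - s)) * f x) - f s| <= e.
Proof.
move=> dS cS' S'0 S'out S0 S1 N0 as_ sb cf fe.
pose t := s + N^-1; have st : s < t by rewrite ltrDl invr_gt0.
pose rho x := N * S' (N * (x - s)).
pose D : set R := `[s, t]%classic.
have DI : D `<=` `]a, b[.
  move=> x; rewrite /D/= !in_itv/= => /andP[sx xt].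
  by rewrite (lt_le_trans as_ sx) (le_lt_trans xt sb).
have rho0 x : ~ D x -> rho x = 0.
  move=> nD; rewrite /rho S'out ?mulr0//; apply: contra_notN nD => /andP[x0 x1].
  rewrite /D/= in_itv/=; move: x0; rewrite pmulr_rgt0// subr_gt0 => /ltW ->/=.
  move: x1; rewrite mulrC -ltr_pdivlMr// div1r ltrBlDr addrC => /ltW; exact.
have crho : continuous rho.
  move=> x; apply: continuousM; first exact: cvg_cst.
  apply: (@continuous_comp _ _ _ (fun y => N * (y - s)) S'); last exact: cS'.
  by apply: continuousM; [exact: cvg_cst|apply: continuousB; [exact: cvg_id|exact: cvg_cst]].
have cD : compact D by exact: segment_compact.
have mD : measurable (D : set (measurableTypeR R)) by exact: measurable_itv.
have irho : mu.-integrable D (EFin \o rho).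
  by apply: continuous_compact_integrable => //; exact: continuous_subspaceT.
have irf : mu.-integrable D (EFin \o (fun x => rho x * f x)).
  apply: continuous_compact_integrable => //.
  apply: (@continuous_in_subspaceT _ _ D) => x; rewrite inE => /DI xI.
  by apply: continuousM; [exact: crho|exact: cf].
have Irho : (\int[mu]_(x in D) rho x = 1)%R.
  pose F x := S (N * (x - s)).
  have dF (x : R) : is_derive x 1 F (rho x).
    rewrite /rho mulrC; apply: (@is_derive1_comp _ S (fun y => N * (y - s))) => //.
    have -> : (fun y => N * (y - s)) = (N *: (id - cst s)) by [].
    by apply: is_derive_eq; rewrite /GRing.scale/= subr0 mulr1.
  have cF : continuous F.
    move=> x; apply: differentiable_continuous; apply/derivable1_diffP.
    by have [] := dF x.
  rewrite /Rintegral (@continuous_FTC2 _ rho F)//.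
  - rewrite /F /t addrAC subrr add0r mulr0 S0 -EFinB/= subr0.
    by rewrite mulfV ?gt_eqF.
  - exact: continuous_subspaceT.
  - split; first by move=> x _; have [] := dF x.
      by apply: cvg_at_right_filter; exact: cF.
    by apply: cvg_at_left_filter; exact: cF.
  - move=> x _; rewrite derive1E; exact: (@derive_val _ _ _ _ _ _ _ (dF x)).
have rf0 x : ~ D x -> rho x * f x = 0 by move=> /rho0 ->; rewrite mul0r.
split.
  apply/integrable_mkcond => //.
  rewrite restrict_EFin (restrict_subset DI rf0) -restrict_EFin.
  apply: (iffLR (integrable_mkcond _ _)); [exact: mD|exact: irf].
have -> : \int[mu]_(x in `]a, b[) (rho x * f x) = \int[mu]_(x in D) (rho x * f x).
  by rewrite Rintegral_mkcond (restrict_subset DI rf0) -Rintegral_mkcond.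
have irfs : mu.-integrable D (EFin \o (fun x => rho x * f s)).
  apply: continuous_compact_integrable => //; apply: continuous_subspaceT => x.
  by apply: continuousM; [exact: crho|exact: cvg_cst].
have -> : f s = \int[mu]_(x in D) (rho x * f s).
  by rewrite RintegralZr// Irho mul1r.
rewrite -RintegralB//.
have irfe : mu.-integrable D (EFin \o (fun x => rho x * e)).
  apply: continuous_compact_integrable => //; apply: continuous_subspaceT => x.
  by apply: continuousM; [exact: crho|exact: cvg_cst].
have idf : mu.-integrable D (EFin \o (fun x => rho x * f x - rho x * f s)).
  have := integrableB mD irf irfs.
  by apply: eq_integrable => // x _ /=; rewrite EFinB.
apply: (le_trans (le_normr_Rintegral mD idf)).
have -> : e = \int[mu]_(x in D) (rho x * e) by rewrite RintegralZr// Irho mul1r.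
apply: le_Rintegral => //.
  exact: (integrable_norm idf).
move=> x; rewrite /D/= in_itv/= => xD.
rewrite -mulrBr normrM ger0_norm ?mulr_ge0 ?(ltW N0)//.
by apply: ler_wpM2l; [rewrite mulr_ge0 ?(ltW N0)|exact: fe].
Qed.

Lemma Rintegral_kernel_cvg (R : realType) (S S' f : R -> R) (a b s : R) :
  (forall x : R, is_derive x 1 S (S' x)) -> continuous S' ->
  (forall x, 0 <= S' x) -> (forall x, ~~ (0 < x < 1) -> S' x = 0) ->
  S 0 = 0 -> S 1 = 1 -> a < s -> s < b -> {in `]a, b[, continuous f} ->
  (\forall n \near \oo, mu.-integrable `]a, b[
     (EFin \o (fun x => n.+1%:R * S' (n.+1%:R * (x - s)) * f x))) /\
  (\int[mu]_(x in `]a, b[) (n.+1%:R * S' (n.+1%:R * (x - s)) * f x))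
    @[n --> \oo] --> f s.
Proof.
move=> dS cS' S'0 S'out S0 S1 as_ sb cf.
have key (e : R) : 0 < e -> \forall n \near \oo, s + n.+1%:R^-1 < b /\
    (forall x, s <= x <= s + n.+1%:R^-1 -> `|f x - f s| <= e).
  move=> e0.
  have /cvgrPdist_le/(_ _ e0) : f x @[x --> s] --> f s.
    by apply: cf; rewrite in_itv/= as_.
  move=> [d /= d0 Hd].
  have H1 : \forall n \near \oo, n.+1%:R^-1 < b - s :> R.
    by apply: (@cvgr_lt _ _ _ _ _ _ (@cvg_harmonic R)); rewrite subr_gt0.
  have H2 : \forall n \near \oo, n.+1%:R^-1 < d :> R.
    exact: (@cvgr_lt _ _ _ _ _ _ (@cvg_harmonic R)).
  near=> n; split.
    by rewrite -ltrBrDl; near: n.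
  move=> x /andP[sx xs]; rewrite distrC; apply: Hd => /=.
  rewrite ler0_norm ?subr_le0// opprB; apply: (@le_lt_trans _ _ (n.+1%:R^-1)).
    by rewrite lerBlDl.
  by near: n.
split.
  have := key 1 ltr01; apply: filterS => n [nb fe].
  have [] // := @Rintegral_kernel R S S' f a b s n.+1%:R 1 dS cS' S'0 S'out S0 S1 _ as_ nb cf fe.
apply/cvgrPdist_le => e e0; have := key e e0; apply: filterS => n [nb fe].
rewrite distrC.
by have [] := @Rintegral_kernel R S S' f a b s n.+1%:R e dS cS' S'0 S'out S0 S1 (ltr0Sn _ _) as_ nb cf fe.
Unshelve. all: by end_near. Qed.

Lemma step_cvg (R : realType) (S : R -> R) (s x : R) :
  (forall x, x <= 0 -> S x = 0) -> (forall x, 1 <= x -> S x = 1) ->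
  S (n.+1%:R * (x - s)) @[n --> \oo] --> ((s < x)%R%:R : R).
Proof.
move=> S0 S1; have [sx|xs] := ltP s x; last first.
  rewrite (_ : (fun n => _) = cst 0); first exact: cvg_cst.
  by apply/funext => n; rewrite S0// mulr_ge0_le0// subr_le0.
apply: cvg_near_cst.
have H : \forall n \near \oo, n.+1%:R^-1 <= x - s :> R.
  by apply: (@cvgr_le _ _ _ _ _ _ (@cvg_harmonic R)); rewrite subr_gt0.
near=> n; rewrite S1// mulrC -ler_pdivrMr ?ltr0Sn// div1r; near: n; exact: H.
Unshelve. all: by end_near. Qed.

(** The test functions [S (n (x - s)) - S (n (x - t))] tend to the indicator of
    [`]s, t]], and their derivatives to the difference of the Dirac masses at
    [s] and [t]. *)
Lemma weak_derivative_Rintegral (R : realType) (a b : R) (f g : R -> R) :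
  {in `]a, b[, continuous f} -> mu.-integrable `]a, b[ (EFin \o g) ->
  (forall phi phi' : R -> R, (forall n, nsmooth n phi) ->
     (forall x : R, is_derive x 1 phi (phi' x)) ->
     (exists c d, [/\ a < c, d < b & forall x, ~~ (c <= x <= d) -> phi x = 0]) ->
     \int[mu]_(x in `]a, b[) (phi' x * f x) =
     - \int[mu]_(x in `]a, b[) (phi x * g x)) ->
  forall s t, a < s -> s < t -> t < b ->
  f t - f s = \int[mu]_(x in `]s, t]) g x.
Proof.
move=> cf ig wk s t as_ st tb.
have [S [S' [sS dS S01 [S0 S1] [cS' S'0 S'out]]]] := smooth_step R.
have [is_ cs] := @Rintegral_kernel_cvg R S S' f a b s dS cS' S'0 S'out
  (S0 _ (lexx _)) (S1 _ (lexx _)) as_ (lt_trans st tb) cf.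
have [it ct] := @Rintegral_kernel_cvg R S S' f a b t dS cS' S'0 S'out
  (S0 _ (lexx _)) (S1 _ (lexx _)) (lt_trans as_ st) tb cf.
pose phi (n : nat) x := S (n.+1%:R * (x - s)) - S (n.+1%:R * (x - t)).
pose phi' (n : nat) x := n.+1%:R * S' (n.+1%:R * (x - s)) -
  n.+1%:R * S' (n.+1%:R * (x - t)).
have aff (n : nat) (c : R) : (fun x => S (n.+1%:R * (x - c))) =
    (fun x => S (n.+1%:R * x + (- (n.+1%:R * c)))).
  by apply/funext => x; rewrite mulrBr.
have sphi n m : nsmooth m (phi n).
  have -> : phi n = (fun x => (fun x => S (n.+1%:R * (x - s))) x +
      (fun x => (-1) * S (n.+1%:R * (x - t))) x).
    by apply/funext => x; rewrite /phi mulN1r.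
  apply: nsmoothD; first by rewrite aff; exact: nsmooth_affine.
  by apply: nsmoothM; [exact: nsmooth_cst|rewrite aff; exact: nsmooth_affine].
have dphi n (x : R) : is_derive x 1 (phi n) (phi' n x).
  have D c : is_derive x 1 (fun x => S (n.+1%:R * (x - c)))
      (n.+1%:R * S' (n.+1%:R * (x - c))).
    rewrite mulrC; apply: (@is_derive1_comp _ S (fun y => n.+1%:R * (y - c))) => //.
    have -> : (fun y => n.+1%:R * (y - c)) = (n.+1%:R *: (id - cst c)) by [].
    by apply: is_derive_eq; rewrite /GRing.scale/= subr0 mulr1.
  exact: is_deriveB.
pose D : set (measurableTypeR R) := `]a, b[%classic.
have mD : measurable D by exact: measurable_itv.
have mg : measurable_fun D g by case/integrableP : ig => /measurable_EFinP.
have cphi n : continuous (phi n).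
  move=> x; apply: differentiable_continuous; apply/derivable1_diffP.
  by have [] := dphi n x.
have phile n x : `|phi n x| <= 1.
  have /andP[? ?] := S01 (n.+1%:R * (x - s)).
  have /andP[? ?] := S01 (n.+1%:R * (x - t)).
  by rewrite /phi ler_norml; lra.
have cvL : \int[mu]_(x in D) (phi' n x * f x) @[n --> \oo] --> f s - f t.
  apply: cvg_trans (cvgB cs ct); apply: near_eq_cvg.
  near=> n; rewrite -[LHS]RintegralB//=; [|near: n; exact: is_|near: n; exact: it].
  by apply: eq_Rintegral => x _; rewrite /phi' mulrBl.
have cvR : \int[mu]_(x in D) (phi n x * g x) @[n --> \oo] -->
    \int[mu]_(x in `]s, t]) g x.
  have mphig n : measurable_fun D (fun x => phi n x * g x).
    apply: measurable_funM => //; apply: measurable_funTS.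
    exact: continuous_measurable_fun.
  have dom n x : D x -> (`|(phi n x * g x)%:E| <= (`|g x|)%:E)%E.
    by move=> _; rewrite lee_fin normrM ler_piMl// phile.
  have ig' : mu.-integrable D (fun x => `|g x|%:E) by exact: (integrable_norm ig).
  have := @dominated_convergence _ _ _ mu D mD (fun n x => (phi n x * g x)%:E)
    (fun x => (g x * (\1_(`]s, t] : set R) x))%:E) (fun x => `|g x|%:E).
  case => //.
  - by move=> n; apply/measurable_EFinP; exact: mphig.
  - apply/measurable_EFinP; apply: measurable_funM => //.
  - apply: aeW => x Dx; apply/cvg_EFin.
      by near=> n.
    rewrite (_ : _ \o _ = fun n => phi n x * g x)//.
    rewrite mulrC; apply: cvgM; last exact: cvg_cst.
    have -> : \1_(`]s, t]%classic : set R) x = (s < x)%R%:R - (t < x)%R%:R :> R.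
      rewrite indicE mem_setE in_itv/= leNgt.
      have [tx|_] := ltP t x; first by rewrite (lt_trans st tx)/= subrr.
      by case: (s < x); rewrite subr0.
    by apply: cvgB; exact: step_cvg.
  - by apply: aeW => x n; exact: dom.
  move=> ilim _; rewrite -(fineK (integrable_fin_num mD ilim)) => /fine_cvg.
  rewrite [X in _ --> X -> _](_ : _ = \int[mu]_(x in `]s, t]) g x); last first.
    transitivity (\int[mu]_(x in D) (g x * \1_(`]s, t]%classic : set R) x)) => //.
    rewrite Rintegral_mkcond [RHS]Rintegral_mkcond; apply: eq_Rintegral => x _.
    rewrite !patchE indicE.
    have [xst|xst] := boolP (x \in (`]s, t]%classic : set R)); last first.
      by rewrite mulr0; case: ifP.
    rewrite mulr1 ifT// inE /D/= in_itv/=.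
    move: xst; rewrite inE /= in_itv/= => /andP[sx xt].
    by rewrite (lt_trans as_ sx) (le_lt_trans xt tb).
  exact.
(* For large [n] the support of [phi n] is compact in [`]a, b[]. *)
have E : \forall n \near \oo, - (\int[mu]_(x in D) (phi n x * g x)) =
    \int[mu]_(x in D) (phi' n x * f x).
  have H : \forall n \near \oo, n.+1%:R^-1 < b - t :> R.
    by apply: (@cvgr_lt _ _ _ _ _ _ (@cvg_harmonic R)); rewrite subr_gt0.
  near=> n; rewrite -(wk (phi n) (phi' n) (sphi n) (dphi n))//.
  exists s, (t + n.+1%:R^-1); split => //; first by rewrite -ltrBrDl; near: n.
  move=> x; rewrite negb_and -!ltNge => /orP[xs|tx].
    rewrite /phi !S0 ?subrr// mulr_ge0_le0// subr_le0 ?ltW//.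
    exact: lt_trans st.
  have H1 c : c <= t -> 1 <= n.+1%:R * (x - c).
    move=> ct'; rewrite mulrC -ler_pdivrMr ?ltr0Sn// div1r lerBrDl ltW//.
    by rewrite (le_lt_trans _ tx)// lerD2r.
  by rewrite /phi !S1 ?subrr ?H1// ltW.

have cvR2 : \int[mu]_(x in D) (phi' n x * f x) @[n --> \oo] -->
    - (\int[mu]_(x in `]s, t]) g x).
  have H : (fun n => \int[mu]_(x in D) (phi' n x * f x)) @ \oo `=>`
      (fun n => - (\int[mu]_(x in D) (phi n x * g x))) @ \oo.
    exact: near_eq_cvg.
  exact: (cvg_trans H (cvgN cvR)).
have EQ : f s - f t = - (\int[mu]_(x in `]s, t]) g x).
  by apply: cvg_unique cvL cvR2; exact: Rhausdorff.
by apply: oppr_inj; rewrite -EQ opprB.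
Unshelve. all: by end_near. Qed.

(** * Continuous functionals of Bochner integrals *)

Section bochner_functional.
Context (R : realType) (X : normedModType R).
Variables (D : set (measurableTypeR R)) (mD : measurable D).
Variables (l : X -> R) (C : R).
Hypotheses (lD : forall x y, l (x + y) = l x + l y)
  (lZ : forall a x, l (a *: x) = a * l x) (lC : forall x, `|l x| <= C * `|x|).

Let l0 : l 0 = 0.
Proof. by rewrite -(scale0r (0 : X)) lZ mul0r. Qed.

Let lB x y : l (x - y) = l x - l y.
Proof. by rewrite lD -scaleN1r lZ mulN1r. Qed.

Let lsum (I : Type) (r : seq I) (F : I -> X) :
  l (\sum_(i <- r) F i) = \sum_(i <- r) l (F i).
Proof. exact: (big_morph l lD l0). Qed.

Lemma integral_simple_functional (s : {fimfun R >-> X}) : integrable_simple D s ->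
  mu.-integrable D (EFin \o (l \o s)) /\
  \int[mu]_(t in D) (l (s t)) = l (simple_integral D s).
Proof.
move=> [ms fs].
pose B x := D `&` s @^-1` [set x].
pose A : seq X := finmap.enum_fset (fset_set (range s)).
have uA : uniq A by exact: finmap.fset_uniq.
pose h x (t : R) : R := l x * \1_(B x) t.
have mB x : measurable (B x : set (measurableTypeR R)) by exact: ms.
have intB x : mu.-integrable D (EFin \o h x) /\
    \int[mu]_(t in D) h x t = fine (mu (B x)) * l x.
  have [->|x0] := eqVneq x 0.
    have -> : h 0 = cst 0 by apply/funext => t; rewrite /h l0 mul0r.
    by rewrite l0 mulr0; split; [exact: integrable0|rewrite Rintegral_cst// mul0r].
  have i1 : mu.-integrable D (EFin \o (\1_(B x) : R -> R)).
    apply/integrableP; split.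
      by apply/measurable_EFinP; apply: measurable_funTS; exact: measurable_indic.
    rewrite (eq_integral (fun t => (\1_(B x) t)%:E)); last first.
      by move=> t _; rewrite gee0_abs// lee_fin indicE.
    by rewrite integral_indic// /B setIAC setIid; exact: fs.
  split.
    rewrite (_ : EFin \o h x = fun t => ((l x)%:E * (\1_(B x) t)%:E)%E).
      exact: integrableZl.
    by apply/funext => t; rewrite /h /= EFinM.
  rewrite RintegralZl// mulrC; congr (_ * _).
  rewrite /Rintegral integral_indic//.
  by rewrite /B setIAC setIid.
have sE t : D t -> l (s t) = \sum_(x <- A) h x t.
  move=> Dt;
  have sA : s t \in A.
    have E := in_fset_set (@fimfunP _ _ s) (s t).
    by apply: (eq_trans E); apply/mem_set; exists t.
  rewrite (bigD1_seq (s t))//= /h indicE mem_set ?mulr1; last by split.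
  rewrite big1 ?addr0// => x xs; rewrite indicE memNset ?mulr0// => -[_ /= sx].
  by rewrite sx eqxx in xs.
have isum : mu.-integrable D (EFin \o (fun t => \sum_(x <- A) h x t)).
  rewrite (_ : EFin \o _ = fun t => (\sum_(x <- A) (h x t)%:E)%E).
    by apply: integrable_sum => // x _; exact: (intB x).1.
  by apply/funext => t /=; rewrite sumEFin.
split.
  by apply: eq_integrable isum => // t; rewrite inE => Dt /=; rewrite sE.
have -> : \int[mu]_(t in D) l (s t) = \int[mu]_(t in D) (\sum_(x <- A) h x t).
  by apply: eq_Rintegral => t; rewrite inE => Dt; rewrite sE.
rewrite /Rintegral.
rewrite (eq_integral (fun t : measurableTypeR R => (\sum_(x <- A) (h x t)%:E)%E)); last first.
  by move=> t _; rewrite sumEFin.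
rewrite (@integral_sum _ _ _ mu D mD _ (fun x t => (h x t)%:E))//; last first.
  by move=> x; exact: (intB x).1.
rewrite /simple_integral fsbig_finite/=; last exact: fimfunP.
rewrite lsum -/A.
rewrite (eq_bigr (fun x => (fine (mu (B x)) * l x)%:E)); last first.
  move=> x _; rewrite -(intB x).2 /Rintegral fineK//.
  by apply: integrable_fin_num => //; exact: (intB x).1.
by rewrite sumEFin/=; apply: eq_bigr => x _; rewrite lZ.
Qed.

(** A continuous functional commutes with the Bochner integral: it does on
    simple functions, and it is Lipschitz.  The real function [F] stands for a
    Borel representative of [l o f], whose Borel measurability cannot be
    deduced from the strong measurability of [f]. *)
Lemma has_bochner_integral_functional (f : R -> X) (v : X) (F : R -> R) :
  has_bochner_integral D f v -> measurable_fun D F ->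
  {ae mu, forall t, D t -> F t = l (f t)} ->
  mu.-integrable D (EFin \o F) /\ \int[mu]_(t in D) F t = l v.
Proof.
move=> [_ [s [is_ cs cv]]] mF [N [mN N0 FN]].
(* A positive Lipschitz constant, by which one can divide. *)
pose C' := `|C| + 1.
have C'0 : 0 < C' by rewrite ltr_wpDl.
have lC' x : `|l x| <= C' * `|x|.
  apply: (le_trans (lC x)); apply: ler_wpM2r => //.
  by apply: (le_trans (ler_norm C)); rewrite lerDl.
pose ls n t := l (s n t).
have ils n := integral_simple_functional (is_ n).
have mls n : measurable_fun D (ls n).
  by have [/integrableP[/measurable_EFinP]] := ils n.
have mFl n : measurable_fun D (fun t => F t - ls n t) by exact: measurable_funB.
pose d n := (\int[mu]_(t in D) `|f t - s n t|%:E)%E.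
pose e n := (\int[mu]_(t in D) `|F t - ls n t|%:E)%E.
have ed n : (e n <= C'%:E * d n)%E.
  pose G t := `|F t - ls n t| * \1_(~` N) t.
  have mG : measurable_fun D G.
    apply: measurable_funM; first exact: measurableT_comp.
    by apply: measurable_funTS; apply: measurable_indic; exact: measurableC.
  have -> : e n = (\int[mu]_(t in D) (G t)%:E)%E.
    apply: ge0_ae_eq_integral => //.
    - by apply/measurable_EFinP; exact: measurableT_comp.
    - exact/measurable_EFinP.
    - by move=> t _; rewrite lee_fin mulr_ge0// indicE.
    exists N; split => // t /= /not_implyP[Dt]; apply: contra_notP => nN.
    by rewrite /G indicE mem_set// mulr1.
  rewrite -lee_pdivrMl// -ge0_integralZl//; last 3 first.
    - exact/measurable_EFinP.
    - by move=> t _; rewrite lee_fin mulr_ge0// indicE.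
    - by rewrite lee_fin invr_ge0 ltW.
  apply: le_nonneg_integral => t Dt; rewrite -EFinM lee_fin.
    by rewrite !mulr_ge0 ?invr_ge0 ?(ltW C'0)// indicE.
  rewrite ler_pdivrMl// /G indicE.
  have [tN|tN] := boolP (t \in ~` N); last by rewrite mulr0 mulr_ge0// ltW.
  rewrite mulr1.
  have -> : F t = l (f t).
    by apply: contrapT => nF; move: tN; rewrite inE; apply; apply: FN => /=; move/(_ Dt).
  by rewrite /ls -lB.
have e0 : e n @[n --> \oo] --> 0%E.
  have cd : (C'%:E * d n)%E @[n --> \oo] --> 0%E.
    by rewrite -(mule0 C'%:E); apply: cvgeZl => //.
  apply: (squeeze_cvge _ _ cd); last exact: cvg_cst.
  by near=> n; rewrite ed integral_ge0.
have esmall r : 0 < r -> \forall n \near \oo, (e n <= r%:E)%E.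
  move=> r0; move/fine_cvgP: e0 => [efin /cvgrPdist_le/(_ r r0)].
  move: efin; apply: filterS2 => n fe; rewrite sub0r normrN => er.
  by rewrite -(fineK fe) lee_fin; apply: le_trans er; exact: ler_norm.
have ifl : \forall n \near \oo, mu.-integrable D (EFin \o (fun t => F t - ls n t)).
  have := esmall 1 ltr01; apply: filterS => n en; apply/integrableP; split.
    exact/measurable_EFinP.
  by apply: (le_lt_trans en); exact: ltry.
have iF : mu.-integrable D (EFin \o F).
  near \oo => n.
  have i1 : mu.-integrable D (EFin \o (fun t => F t - ls n t)) by near: n; exact: ifl.
  have := integrableD mD i1 (ils n).1.
  by apply: eq_integrable => // t _ /=; rewrite -EFinD subrK.
split => //.
have cl : l (simple_integral D (s n)) @[n --> \oo] --> l v.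
  apply/cvgrPdist_le => r r0.
  have /cvgrPdist_le/(_ (r / C')) := cv.
  rewrite divr_gt0// => /(_ isT); apply: filterS => n nr.
  by rewrite -lB (le_trans (lC' _))// mulrC -ler_pdivlMr.
have cF : l (simple_integral D (s n)) @[n --> \oo] --> \int[mu]_(t in D) F t.
  apply/cvgrPdist_le => r r0.
  have := esmall r r0.
  move: ifl; apply: filterS2 => n i1 er.
  rewrite -(ils n).2 -RintegralB//; last exact: (ils n).1.
  apply: (le_trans (le_normr_Rintegral mD i1)).
  by rewrite -lee_fin /Rintegral fineK// ge0_fin_numE ?integral_ge0// (le_lt_trans er) ?ltry.
by apply: cvg_unique cF cl; exact: Rhausdorff.
Unshelve. all: by end_near. Qed.
End bochner_functional.

(** A functional turns the weak derivative of a vector-valued function into a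
    real one, to which [weak_derivative_Rintegral] applies. *)
Lemma weak_derivative_functional (R : realType) (X : normedModType R)
    (a b C : R) (l : X -> R) (u du : R -> X) (lg : R -> R) :
  (forall x y, l (x + y) = l x + l y) -> (forall k x, l (k *: x) = k * l x) ->
  (forall x, `|l x| <= C * `|x|) ->
  {in `]a, b[, continuous u} -> weak_derivative `]a, b[ u du ->
  mu.-integrable `]a, b[ (EFin \o lg) ->
  {ae mu, forall t, a < t < b -> lg t = l (du t)} ->
  forall s t, a < s -> s < t -> t < b ->
  l (u t) - l (u s) = \int[mu]_(x in `]s, t]) lg x.
Proof.
move=> lD lZ lC cu wu ilg aelg s t as_ st tb.
have l0 : l 0 = 0 by rewrite -(scale0r (0 : X)) lZ mul0r.
have lN x : l (- x) = - l x by rewrite -scaleN1r lZ mulN1r.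
have cl : continuous l.
  move=> x; apply/cvgrPdist_le => e e0.
  have C'0 : 0 < `|C| + 1 by rewrite ltr_wpDl.
  have : \forall y \near x, `|x - y| <= e / (`|C| + 1).
    by apply: cvgr_dist_le; [exact: cvg_id|exact: divr_gt0].
  apply: filterS => y xy; rewrite -lN -lD (le_trans (lC _))//.
  apply: (@le_trans _ _ ((`|C| + 1) * `|x - y|)).
    by apply: ler_wpM2r => //; rewrite (le_trans (ler_norm C))// lerDl.
  by rewrite mulrC -ler_pdivlMr.
pose D : set (measurableTypeR R) := `]a, b[%classic.
have mD : measurable D by exact: measurable_itv.
have clu : {in `]a, b[, continuous (l \o u)}.
  by move=> x xI; apply: continuous_comp; [exact: cu|exact: cl].
apply: (weak_derivative_Rintegral clu ilg _ as_ st tb).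
move=> phi phi' sphi dphi [c [d [ac db phi0]]].
have E' : (phi : R -> R^o)^`()%classic = phi'.
  by apply/funext => y; rewrite derive1E; exact: (@derive_val _ _ _ _ _ _ _ (dphi y)).
have tf : test_function `]a, b[ (phi : R -> R^o).
  split; first by move=> n x; exact: nsmooth_derivable.
  exists `[c, d]%classic; split.
  - exact: segment_compact.
  - move=> x /=; rewrite !in_itv/= => /andP[cx xd].
    by rewrite (lt_le_trans ac cx) (le_lt_trans xd db).
  - by move=> x cdx; apply: phi0; apply/negP => H; apply: cdx; rewrite /= in_itv.
have [v [b1 b2]] := wu phi tf.
have cphi : continuous phi.
  move=> x; apply: differentiable_continuous; apply/derivable1_diffP.
  by have [] := dphi x.
have cphi' : continuous phi'.
  have [T dT [T' dT' _]] := sphi 2%N.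
  have -> : phi' = T.
    apply/funext => x; rewrite -(@derive_val _ _ _ _ _ _ _ (dphi x)).
    by rewrite -(@derive_val _ _ _ _ _ _ _ (dT x)).
  move=> x; apply: differentiable_continuous; apply/derivable1_diffP.
  by have [] := dT' x.
have mlu : measurable_fun D (l \o u).
  apply: subspace_continuous_measurable_fun; first exact: measurable_itv.
  by apply: (@continuous_in_subspaceT _ _ D) => x; rewrite inE; exact: clu.
have mlg : measurable_fun D lg by case/integrableP : ilg => /measurable_EFinP.
have m1 : measurable_fun D (fun t => phi' t * l (u t)).
  apply: measurable_funM => //; apply: measurable_funTS.
  exact: continuous_measurable_fun.
have m2 : measurable_fun D (fun t => phi t * lg t).
  apply: measurable_funM => //; apply: measurable_funTS.
  exact: continuous_measurable_fun.
have ae1 : {ae mu, forall t, D t ->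
    phi' t * l (u t) = l ((phi : R -> R^o)^`()%classic t *: u t)}.
  by apply: aeW => x _; rewrite lZ E'.
have ae2 : {ae mu, forall t, D t -> phi t * lg t = l (phi t *: du t)}.
  move: aelg; apply: filterS; first exact: (ae_filter_ringOfSetsType mu).
  by move=> x H; rewrite /D/= in_itv/= => /H ->; rewrite lZ.
have [_ ->] := has_bochner_integral_functional mD lD lZ lC b1 m1 ae1.
have [_ ->] := has_bochner_integral_functional mD lD lZ lC b2 m2 ae2.
by rewrite lN opprK.
Qed.

(** The approximating simple functions converge pointwise outside of a null set
    [N]; there, limits of Borel functions are Borel, and the values of these
    simple functions are a countable set adherent to all values of [f]. *)
Lemma strongly_measurable_comp (R : realType) (X : normedModType R)
    (D : set (measurableTypeR R)) (f : R -> X) : measurable D ->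
  strongly_measurable D f -> exists N : set (measurableTypeR R),
  [/\ measurable N, mu N = 0,
    forall h : X -> R, continuous h -> measurable_fun (D `\` N) (h \o f) &
    exists c : nat -> X, forall t, D t -> ~ N t -> forall e, 0 < e ->
      exists k, `|f t - c k| < e].
Proof.
move=> mD [s [ms [N [mN N0 sN]]]].
have cvs t : D t -> ~ N t -> s n t @[n --> \oo] --> f t.
  by move=> Dt Nt; apply: contrapT => H; apply: Nt; apply: sN => /= /(_ Dt).
exists N; split => //.
  move=> h ch.
  have mDN : measurable (D `\` N) by exact: measurableD.
  apply: (@measurable_fun_cvg _ _ _ _ (fun n => h \o s n)).
    move=> n; apply: measurable_funS mD _ _; first exact: subDsetl.
    move=> _ Y mY.
    have -> : D `&` (h \o s n) @^-1` Y =
        \bigcup_(x in range (s n) `&` (h @^-1` Y)) (D `&` s n @^-1` [set x]).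
      apply/seteqP; split => [t [Dt /= Yt]|t [x [_ Yx] [Dt /= E]]].
        by exists (s n t) => //; split => //; exists t.
      by split => //=; rewrite /preimage/= E.
    apply: fin_bigcup_measurable => [|x _]; last exact: ms.
    by apply: sub_finite_set (@fimfunP _ _ (s n)); exact: subIsetl.
  move=> t [Dt Nt]; exact: (cvg_comp _ _ (cvs t Dt Nt) (ch (f t))).
(* [c] enumerates the values of all the approximating simple functions. *)
pose A n : seq X := finmap.enum_fset (fset_set (range (s n))).
pose c (k : nat) : X := if unpickle k is Some (n, i) then nth 0 (A n) i else 0.
exists c => t Dt Nt e e0.
have /cvgrPdist_lt/(_ e e0) [n _ /(_ n (leqnn n)) /= fs] := cvs t Dt Nt.
have sA : s n t \in A n.
  have E := in_fset_set (@fimfunP _ _ (s n)) (s n t).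
  by apply: (eq_trans E); apply/mem_set; exists t.
exists (pickle (n, index (s n t) (A n))).
by rewrite /c pickleK nth_index.
Qed.

(** Replacing [du] by [0] on the exceptional null sets of the intervals
    [`]0, m + 1[] gives a function that is well behaved on the whole line. *)
Lemma borel_representative (R : realType) (X : normedModType R) (du : R -> X) :
  (forall T : R, 0 < T -> strongly_measurable `]0, T[ du) ->
  exists g : R -> X,
  [/\ {ae mu, forall t : R, 0 < t -> g t = du t},
    forall t, g t = du t \/ g t = 0,
    forall h : X -> R, continuous h -> measurable_fun setT (h \o g) &
    exists c : nat -> X, forall t e, 0 < e -> exists k, `|g t - c k| < e].
Proof.
move=> sm.
pose D (m : nat) : set (measurableTypeR R) := `]0, m.+1%:R[%classic.
have mD m : measurable (D m) by exact: measurable_itv.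
have /choice[N HN] : forall m, exists Nm : set (measurableTypeR R),
  [/\ measurable Nm, mu Nm = 0,
    forall h : X -> R, continuous h -> measurable_fun (D m `\` Nm) (h \o du) &
    exists c : nat -> X, forall t, D m t -> ~ Nm t -> forall e, 0 < e ->
      exists k, `|du t - c k| < e].
  by move=> m; apply: strongly_measurable_comp; [exact: mD|exact: sm].
have /choice[c Hc] : forall m, exists c : nat -> X, forall t, D m t -> ~ N m t ->
    forall e, 0 < e -> exists k, `|du t - c k| < e.
  by move=> m; have [] := HN m.
pose NN := \bigcup_m N m.
have mNN : measurable NN by apply: bigcup_measurable => m _; have [] := HN m.
have NN0 : mu NN = 0.
  have : mu.-negligible NN.
    by apply: negligible_bigcup => m; have [mN N0 _ _] := HN m; exists (N m); split.
  by move/(negligibleP _ mNN).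
have inD (t : R) : 0 < t -> exists m, D m t.
  move=> t0; exists (Num.truncn t); rewrite /D/= in_itv/= t0/=.
  by have /andP[] := truncn_itv (ltW t0).
pose g t := if (0 < t) && (t \notin NN) then du t else 0.
have gE t : 0 < t -> ~ NN t -> g t = du t.
  by move=> t0 nN; rewrite /g t0/= ifT//; apply/negP; rewrite inE.
exists g; split.
- exists NN; split => // t /= /not_implyP[t0]; apply: contra_notP => nN; exact: gE.
- by move=> t; rewrite /g; case: ifP; [left|right].
- move=> h ch.
  have mDN m : measurable (D m `\` NN) by exact: measurableD.
  pose B := \bigcup_m (D m `\` NN).
  have mB : measurable B by apply: bigcup_measurable => m _; exact: mDN.
  have -> : setT = B `|` ~` B by rewrite setUv.
  apply/measurable_funU => //; first exact: measurableC.
  split.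
    apply/measurable_fun_bigcup; first exact: mDN.
    move=> m.
    have [_ _ Hm _] := HN m.
    apply: (eq_measurable_fun (h \o du)).
      move=> t; rewrite inE => -[]; rewrite /D/= in_itv/= => /andP[t0 _] nN.
      by rewrite /= gE.
    apply: measurable_funS (Hm h ch).
      by apply: measurableD => //; have [] := HN m.
    by apply: setDS => t Nt; exists m.
  apply: (eq_measurable_fun (cst (h 0))) => // t; rewrite inE => nB.
  rewrite /= /g; case: ifPn => // /andP[t0 /negP nN]; exfalso; apply: nB.
  have [m Dm] := inD _ t0; exists m => //; split => // Nt; apply: nN; exact/mem_set.
(* The entry of index 0 is spent on the value [0] of [g] off [`]0, +oo[] and on
   the null sets. *)
pose cc (k : nat) : X := if k is k'.+1 then
  if unpickle k' is Some (m, i) then c m i else 0 else 0.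
exists cc => t e e0.
rewrite /g; case: ifPn => [/andP[t0 /negP nN]|_]; last first.
  by exists 0%N; rewrite subr0 normr0.
have [m Dm] := inD _ t0.
have [|k Hk] := Hc m t Dm _ e e0.
  by move=> Nt; apply: nN; apply/mem_set; exists m.
by exists (pickle (m, k)).+1; rewrite /cc pickleK.
Qed.

(** * Inner product *)

Section hilbert.
Context (R : realType) (H : normedModType R) (dot : {dot H for idfun}).
Hypothesis dot_norm : forall v : H, dot v v = `|v| ^+ 2.

Lemma dotDl x y z : dot (x + y) z = dot x z + dot y z.
Proof. exact: linearDl. Qed.
Lemma dotZl a x z : dot (a *: x) z = a * dot x z.
Proof. exact: linearZl_LR. Qed.
Lemma dotC x y : dot x y = dot y x.
Proof. by rewrite hermC/= expr0 mul1r. Qed.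
Lemma dotDr x y z : dot z (x + y) = dot z x + dot z y.
Proof. by rewrite dotC dotDl !(dotC z). Qed.
Lemma dotZr a x z : dot z (a *: x) = a * dot z x.
Proof. by rewrite dotC dotZl dotC. Qed.
Lemma dotNl x z : dot (- x) z = - dot x z.
Proof. by rewrite -scaleN1r dotZl mulN1r. Qed.
Lemma dotNr x z : dot z (- x) = - dot z x.
Proof. by rewrite -scaleN1r dotZr mulN1r. Qed.
Lemma dotBl x y z : dot (x - y) z = dot x z - dot y z.
Proof. by rewrite dotDl dotNl. Qed.
Lemma dotBr x y z : dot z (x - y) = dot z x - dot z y.
Proof. by rewrite dotDr dotNr. Qed.
Lemma dot0r z : dot z 0 = 0.
Proof. by rewrite -(scale0r (0 : H)) dotZr mul0r. Qed.

Lemma norm2D x y : `|x + y| ^+ 2 = `|x| ^+ 2 + 2 * dot x y + `|y| ^+ 2.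
Proof. by rewrite -!dot_norm dotDl !dotDr (dotC y x); ring. Qed.

(** Cauchy-Schwarz, from [| |y| x - |x| y |^2 >= 0]. *)
Lemma dot_le_norm x y : dot x y <= `|x| * `|y|.
Proof.
have [->|x0] := eqVneq x 0; first by rewrite dotC dot0r normr0 mul0r.
have [->|y0] := eqVneq y 0; first by rewrite dot0r normr0 mulr0.
have nx : 0 < `|x| by rewrite normr_gt0.
have ny : 0 < `|y| by rewrite normr_gt0.
have := sqr_ge0 (`| `|y| *: x - `|x| *: y |).
rewrite norm2D !normrN !normrZ !normr_id dotNr dotZl dotZr => h.
have : 0 <= (`|x| * `|y|) * (`|x| * `|y| - dot x y) by nra.
by rewrite pmulr_rge0 ?mulr_gt0// subr_ge0.
Qed.

Lemma norm_dot_le x y : `|dot x y| <= `|x| * `|y|.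
Proof.
by rewrite ler_norml dot_le_norm andbT lerNl -dotNl -(normrN x) dot_le_norm.
Qed.
End hilbert.

(** * Almost everywhere differentiability of indefinite integrals *)

Lemma is_derive_epsP (R : realType) (V : normedModType R) (u : R -> V) (t : R) (d : V) :
  is_derive t 1 u d <-> (forall e, 0 < e -> exists2 r, 0 < r &
    forall h : R, `|h| < r -> `|u (t + h) - u t - h *: d| <= e * `|h|).
Proof.
have E : is_derive t 1 u d <->
    (h^-1 *: (u (h *: 1 + t) - u t) @[h --> (0:R)^'] --> d).
  split=> [[du Du]|cv]; first by rewrite -Du; exact: du.
  by apply: DeriveDef; [apply/cvg_ex; exists d|apply/cvg_lim].
apply: (iff_trans E); split=> [/cvgrPdist_le cv e e0|cv].
  have [r /= r0 Hr] := cv _ e0; exists r => // h hr.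
  have [->|h0] := eqVneq h 0; first by rewrite addr0 subrr scale0r subr0 !normr0 mulr0.
  have := Hr h; rewrite /= sub0r normrN => /(_ hr h0).
  rewrite /GRing.scale/= mulr1 -(ler_pM2r (x := `|h|)) ?normr_gt0//; apply: le_trans.
  rewrite mulrC -normrZ scalerBr scalerA mulfV// scale1r.
  by rewrite -normrN opprB [h + t]addrC.
apply/cvgrPdist_le => e e0; have [r r0 Hr] := cv e e0.
exists r => //= h /=; rewrite sub0r normrN => hr h0.
rewrite -(ler_pM2l (x := `|h|)) ?normr_gt0// -normrZ mulrC [h *: 1]mulr1.
rewrite scalerBr scalerA mulfV// scale1r -normrN opprB [h + t]addrC; exact: Hr.
Qed.

Lemma near_backward_quotient (R : realType) (V : normedModType R) (u : R -> V) (r : R) (d : V) :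
  is_derive r 1 u d -> forall e, 0 < e -> \forall n \near \oo,
    `|u (r - n.+1%:R^-1) - u r + n.+1%:R^-1 *: d| <= e * n.+1%:R^-1.
Proof.
move=> /is_derive_epsP du e e0; have [rho rho0 Hrho] := du e e0.
have : \forall n \near \oo, n.+1%:R^-1 < rho :> R.
  exact: (@cvgr_lt _ _ _ _ _ _ (@cvg_harmonic R)).
apply: filterS => n nr; have := Hrho (- n.+1%:R^-1).
rewrite normrN gtr0_norm ?invr_gt0// => /(_ nr).
by rewrite scaleNr opprK.
Qed.

(** Lebesgue differentiation on an interval: the integral is taken of the
    extension of [v] by [0], which is integrable on the line. *)
(** Almost every [t] is a Lebesgue point of all the functions [|g - c_k|], where
    the [c_k] are dense in the range of [g].  By [norm_increment_le], at such a
    [t] the difference quotient of [u] is within [|g t - c_k|] of [c_k] up to an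
    arbitrarily small error. *)
Lemma ae_is_derive_integral (R : realType) (v : R -> R) (a b : R) :
  mu.-integrable `]a, b[ (EFin \o v) -> exists V : R -> R,
  (forall s t, a <= s -> s <= t -> t < b -> V t - V s = \int[mu]_(x in `]s, t]) v x) /\
  {ae mu, forall r, a < r < b -> is_derive r 1 V (v r)}.
Proof.
move=> iv; pose D : set (measurableTypeR R) := `]a, b[%classic.
have mD : measurable D by exact: measurable_itv.
pose f := v \_ (`]a, b[ : set R).
have if_ : mu.-integrable setT (EFin \o f).
  rewrite /f -restrict_EFin.
  by apply: (iffLR (integrable_mkcond _ _)); [exact: mD|exact: iv].
have lf : locally_integrable setT f.
  by apply: open_integrable_locally; [exact: openT|exact: if_].
pose F (x : R) := \int[mu]_(t in `]-oo, x]) f t.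
exists F; split.
  move=> s t as_ st tb; rewrite /F Rintegral_itvB//; last first.
    by apply: integrableS if_ => //; exact: measurable_itv.
  apply: eq_Rintegral => x; rewrite inE/= in_itv/= => /andP[sx xt].
  by rewrite /f patchE mem_set//= in_itv/= (le_lt_trans as_ sx)/= (le_lt_trans xt tb).
have : {ae mu, forall x, derivable F x 1 /\ F^`()%classic x = f x}.
  by apply: FTC1Ny => // y; apply: integrableS if_ => //; exact: measurable_itv.
apply: filterS; first exact: (ae_filter_ringOfSetsType mu).
move=> r [d1 d2] rab.
have -> : v r = f r by rewrite /f patchE mem_set//= in_itv/=.
by apply: DeriveDef => //; rewrite -d2 derive1E.
Qed.

(** [g] is integrable and [u] is its indefinite integral in the weak sense only;
    the norm estimates below recover strong statements. *)
Section indefinite_integral.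
Context (R : realType) (H : normedModType R) (dot : {dot H for idfun}).
Hypothesis dot_norm : forall v : H, dot v v = `|v| ^+ 2.
Variables (u g : R -> H).
Hypothesis mg : forall h : H -> R, continuous h -> measurable_fun setT (h \o g).
Hypothesis g2 : forall T : R, 0 < T ->
  (\int[mu]_(t in `]0%R, T[) (`|g t| ^+ 2)%:E < +oo)%E.
Hypothesis ug : forall (w : H) (s t : R), 0 < s -> s < t ->
  dot (u t - u s) w = \int[mu]_(x in `]s, t]) dot (g x) w.
Hypothesis gsep : exists c : nat -> H, forall t e, 0 < e -> exists k, `|g t - c k| < e.

Lemma measurable_dist (x : H) : measurable_fun setT (fun t => `|g t - x|).
Proof.
apply: (mg (h := fun y => `|y - x|)) => y.
by apply: cvg_norm; apply: cvgB; [exact: cvg_id|exact: cvg_cst].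
Qed.

Lemma measurable_norm : measurable_fun setT (fun t => `|g t|).
Proof. by apply: (mg (h := fun y => `|y|)) => y; apply: cvg_norm; exact: cvg_id. Qed.

Lemma measurable_dot (w : H) : measurable_fun setT (fun t => dot (g t) w).
Proof.
apply: (mg (h := fun y => dot y w)) => y; apply/cvgrPdist_le => e e0.
have C0 : 0 < `|w| + 1 by rewrite ltr_wpDl.
have : \forall z \near y, `|y - z| <= e / (`|w| + 1).
  by apply: cvgr_dist_le; [exact: cvg_id|exact: divr_gt0].
apply: filterS => z; rewrite ler_pdivlMr// => yz.
rewrite -dotBl (le_trans (norm_dot_le dot_norm _ _))// (le_trans _ yz)//.
by apply: ler_wpM2l => //; rewrite lerDl.
Qed.

Lemma integrable_dist (x : H) (T : R) : 0 < T ->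
  mu.-integrable `]0, T[ (EFin \o (fun t => `|g t - x|)).
Proof.
move=> T0; pose D : set (measurableTypeR R) := `]0, T[%classic.
have mD : measurable D by exact: measurable_itv.
have icst : mu.-integrable D (EFin \o cst (1 + `|x|)).
  have muD : (mu D < +oo)%E by rewrite /D lebesgue_measure_itv/= lte_fin T0 -EFinB ltry.
  by apply: measurable_bounded_integrable => //; exact: bounded_cst.
have i2 : mu.-integrable D (EFin \o (fun t => `|g t| ^+ 2)).
  apply/integrableP; split.
    by apply/measurable_EFinP; apply: measurable_funTS; apply: measurable_funX; exact: measurable_norm.
  apply: le_lt_trans (g2 T0); apply: le_nonneg_integral => t _ //.
  by rewrite /= ger0_norm// exprn_ge0.
have i3 := integrableD mD icst i2.
apply: (le_integrable mD _ _ i3).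
  by apply/measurable_EFinP; apply: measurable_funTS; exact: measurable_dist.
move=> t _ /=; rewrite lee_fin normr_id.
apply: (@le_trans _ _ (1 + `|x| + `|g t| ^+ 2)); last exact: ler_norm.
apply: (le_trans (ler_normB _ _)); have := sqr_ge0 (`|g t| - 2^-1); nra.
Qed.

(** The weak formula is tested with [w := u t - u s - (t - s) x] itself, which
    replaces the triangle inequality for vector-valued integrals. *)
Lemma norm_increment_le (x : H) (s t : R) : 0 < s -> s < t ->
  `|u t - u s - (t - s) *: x| <= \int[mu]_(r in `]s, t]) `|g r - x|.
Proof.
move=> s0 st; pose w := u t - u s - (t - s) *: x.
pose D : set (measurableTypeR R) := `]s, t]%classic.
have mD : measurable D by exact: measurable_itv.
have muD : mu D = (t - s)%:E by rewrite /D lebesgue_measure_itv/= lte_fin st.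
have DT : D `<=` `]0, t + 1[.
  move=> r; rewrite /D/= !in_itv/= => /andP[sr rt].
  by rewrite (lt_trans s0 sr)/= (le_lt_trans rt)// ltrDl.
have idist y : mu.-integrable D (EFin \o (fun r => `|g r - y|)).
  apply: integrableS DT (integrable_dist _ _) => //.
  by rewrite addr_gt0// (lt_trans s0).
have icst (c : R) : mu.-integrable D (EFin \o cst c).
  have muDoo : (mu D < +oo)%E by rewrite muD ltry.
  by apply: measurable_bounded_integrable => //; exact: bounded_cst.
have iw : mu.-integrable D (EFin \o (fun r => `|g r - x| * `|w|)).
  exact: (integrableZr mD `|w| (idist x)).
have idot y : mu.-integrable D (EFin \o (fun r => dot (g r) y)).
  have i0 := integrableZr mD `|y| (idist 0).
  apply: (le_integrable mD _ _ i0).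
    by apply/measurable_EFinP; apply: measurable_funTS; exact: measurable_dot.
  move=> r _ /=; rewrite subr0 lee_fin normrM !normr_id.
  exact: norm_dot_le dot_norm _ _.
have : `|w| ^+ 2 <= (\int[mu]_(r in D) `|g r - x|) * `|w|.
  have -> : `|w| ^+ 2 = \int[mu]_(r in D) (dot (g r) w - dot x w).
    rewrite RintegralB//; last exact: icst.
    have Icst (k : R) : \int[mu]_(r in D) k = k * (t - s).
      by rewrite Rintegral_cst//; congr (_ * _); exact: (congr1 fine muD).
    rewrite Icst -ug// -dot_norm {1}/w dotBl dotZl mulrC.
    by [].
  rewrite -RintegralZr//; apply: le_Rintegral => //.
    have := integrableB mD (idot w) (icst (dot x w)).
    by apply: eq_integrable => // r _ /=; rewrite EFinB.
  by move=> r _; rewrite -dotBl; exact: dot_le_norm.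
rewrite -/w => h; have [->|w0] := eqVneq w 0.
  by rewrite normr0; apply: Rintegral_ge0.
by move: h; rewrite expr2 ler_pM2r// normr_gt0.
Qed.

Lemma ae_is_derive : {ae mu, forall t : R, 0 < t -> is_derive t 1 u (g t)}.
Proof.
have [c gc] := gsep.
have /choice[F FP] : forall km : nat * nat, exists V : R -> R,
    (forall s t : R, 0 <= s -> s <= t -> t < km.2.+1%:R ->
      V t - V s = \int[mu]_(x in `]s, t]) `|g x - c km.1|) /\
    {ae mu, forall r : R, 0 < r < km.2.+1%:R -> is_derive r 1 V `|g r - c km.1|}.
  by move=> km; apply: ae_is_derive_integral; exact: integrable_dist.
have aeF : {ae mu, forall r : R, forall k m, 0 < r < m.+1%:R ->
    is_derive r 1 (F (k, m)) `|g r - c k|}.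
  have A k := ae_foralln (fun m => (FP (k, m)).2).
  exact: ae_foralln A.
move: aeF; apply: filterS; first exact: (ae_filter_ringOfSetsType mu).
move=> t dF t0.
pose m := Num.truncn t.
have tm : t < m.+1%:R by have /andP[] := truncn_itv (ltW t0).
have FB k r q : 0 < r -> r < q -> q < m.+1%:R ->
    `|u q - u r - (q - r) *: c k| <= F (k, m) q - F (k, m) r.
  move=> r0 rq qm; rewrite (FP (k, m)).1 ?(ltW r0) ?(ltW rq)//=.
  exact: (norm_increment_le _ r0 rq).
apply/is_derive_epsP => e e0.
have e20 : 0 < e / 3 by rewrite divr_gt0.
have [k gk] := gc t (e / 3) e20.
(* [e / 3] is spent twice on the distance of [g t] to [c k] and once on the
   differentiability of [F (k, m)]. *)
have {dF} := dF k m; rewrite t0 tm => /(_ isT) /(@is_derive_epsP _ R^o) dF.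
have [r r0 Hr] := dF _ e20.
exists (Num.min r (Num.min t (m.+1%:R - t))).
  by rewrite !lt_min r0 t0 subr_gt0.
move=> h; rewrite !lt_min => /and3P[hr ht hm].
have := Hr h hr; rewrite /GRing.scale/= => FH.
have hF : `|F (k, m) (t + h) - F (k, m) t| <= 2 * (e / 3) * `|h|.
  have -> : F (k, m) (t + h) - F (k, m) t =
      (F (k, m) (t + h) - F (k, m) t - h * `|g t - c k|) + h * `|g t - c k| by rewrite subrK.
  apply: (le_trans (ler_normD _ _)); rewrite -mulrA mulr2n mulrDl mul1r lerD//.
  by rewrite normrM normr_id mulrC ler_wpM2r// ltW.
have uc : `|u (t + h) - u t - h *: c k| <= `|F (k, m) (t + h) - F (k, m) t|.
  have := ltr_norml h t; have := ltr_norml h (m.+1%:R - t).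
  rewrite ht hm => /esym/andP[_ h2] /esym/andP[h1 _].
  have [hn|hp|->] := ltgtP h 0; last by rewrite addr0 !subrr scale0r subr0 normr0.
    have H1 : 0 < t + h by rewrite -ltrBlDl sub0r.
    have H2 : t + h < t by rewrite gtrDl.
    have := FB k _ _ H1 H2 tm; rewrite [X in X *: _](_ : _ = - h); last by ring.
    move=> HF; rewrite [leRHS]distrC; apply: le_trans (le_trans HF (ler_norm _)).
    by rewrite scaleNr opprK -normrN !opprD !opprK [- u (t + h) + _]addrC.
  have H1 : t < t + h by rewrite ltrDl.
  have H2 : t + h < m.+1%:R by rewrite -ltrBrDl.
  have := FB k _ _ t0 H1 H2; rewrite [X in X *: _](_ : _ = h); last by ring.
  by move=> HF; apply: le_trans (le_trans HF (ler_norm _)).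
have -> : u (t + h) - u t - h *: g t = (u (t + h) - u t - h *: c k) - h *: (g t - c k).
  by rewrite scalerBr opprB addrA subrK.
apply: (le_trans (ler_normB _ _)).
have -> : e * `|h| = 2 * (e / 3) * `|h| + `|h| * (e / 3) by field.
apply: lerD; first exact: le_trans hF.
by rewrite normrZ ler_wpM2l// ltW.
Qed.
End indefinite_integral.

(** * Subgradients *)

Lemma limf_einf_right_le (R : realType) (f : R -> \bar R) (B : \bar R) :
  (forall l, 0 < l < 1 -> (f l <= B)%E) -> (limf_einf f (0:R)^'+ <= B)%E.
Proof.
move=> fB; rewrite limf_einfE; apply: ge_ereal_sup => _ [V FV <-].
have : \forall l \near (0:R)^'+, V l /\ 0 < l < 1.
  near=> l; split; first by near: l.
  apply/andP; split; near: l; [exact: nbhs_right_gt|exact: nbhs_right_lt].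
move=> /filter_ex [l [Vl l01]].
by apply: le_trans (fB l l01); apply: ereal_inf_lbound; exists l.
Unshelve. all: by end_near. Qed.

Lemma limf_einf_right_ge (R : realType) (f : R -> \bar R) (a : R) :
  (forall e, 0 < e -> \forall l \near (0:R)^'+, ((a - e)%:E <= f l)%E) ->
  (a%:E <= limf_einf f (0:R)^'+)%E.
Proof.
move=> fa; apply/lee_subgt0Pr => e e0; rewrite limf_einfE.
apply: (le_trans _ (ereal_sup_ubound _)); last first.
  by exists [set l | ((a - e)%:E <= f l)%E]; [exact: fa|reflexivity].
by apply: le_ereal_inf_tmp => _ [l /= fl <-].
Qed.

Lemma near_limf_einf_right (R : realType) (f : R -> \bar R) (a e : R) :
  (a%:E <= limf_einf f (0:R)^'+)%E -> 0 < e ->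
  \forall l \near (0:R)^'+, ((a - e)%:E <= f l)%E.
Proof.
rewrite limf_einfE => fa e0.
have : ((a - e)%:E < ereal_sup [set ereal_inf (f @` V) | V in (0:R)^'+])%E.
  by apply: lt_le_trans fa; rewrite lte_fin ltrBlDr ltrDl.
move=> /ereal_sup_gt [_ [V FV <-]] aV; apply: filterS FV => l Vl.
by apply: (le_trans (ltW aV)); apply: ereal_inf_lbound; exists l.
Qed.

Section subgradient.
Context (R : realType) (H : normedModType R) (dot : {dot H for idfun}).
Hypothesis dot_norm : forall v : H, dot v v = `|v| ^+ 2.
Variable E : H -> \bar R.
Hypothesis E_proper : proper_functional E.

Lemma dom_fin_num v : dom E v -> E v \is a fin_num.
Proof.
by move=> Ev; rewrite fin_numE E_proper.1/= lt_eqF.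
Qed.

(** Comparing [E] with its chord from [v] to [w] bounds the directional
    derivative at [v] in the direction [w - v]; the quadratic term of
    semiconvexity costs [om / 2 |w - v|^2]. *)
Lemma semiconvex_subgradient_le : semiconvex E -> exists2 K : R, 0 <= K &
  forall v f, subgradient dot E v f -> forall w,
  ((fine (E v) + dot f (w - v) - K * `|w - v| ^+ 2)%:E <= E w)%E.
Proof.
move=> [om cvx]; exists (`|om| / 2); first by rewrite divr_ge0.
move=> v f [Ev fE] w.
have Evf := dom_fin_num Ev.
have [Ew|Ew] := eqVneq (E w) +oo%E; first by rewrite Ew leey.
have Ewf : E w \is a fin_num by rewrite fin_numE E_proper.1.
set r1 := fine (E v); set r2 := fine (E w).
have E1 : E v = r1%:E by rewrite fineK.
have E2 : E w = r2%:E by rewrite fineK.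
suff : ((dot f (w - v))%:E <= (r2 - r1 + `|om| / 2 * `|w - v| ^+ 2)%:E)%E.
  by rewrite E2 !lee_fin; lra.
apply: (le_trans (fE (w - v))); apply: limf_einf_right_le => l /andP[l0 l1].
have := cvx w v l; rewrite (ltW l0) (ltW l1) => /(_ isT).
have -> : l *: w + (1 - l) *: v = v + l *: (w - v).
  by rewrite scalerBl scalerBr scale1r addrCA.
set x := v + l *: (w - v).
rewrite E1 E2 -!(EFinD, EFinM).
have [Ex|Ex] := eqVneq (E x) +oo%E; first by rewrite Ex.
have Exf : E x \is a fin_num by rewrite fin_numE E_proper.1.
rewrite -(fineK Exf) -!EFinD -EFinM !lee_fin; set r := fine (E x) => h.
rewrite ler_pdivrMr// mulrC.
have nx : `|x| ^+ 2 = l * `|w| ^+ 2 + (1 - l) * `|v| ^+ 2 - l * (1 - l) * `|w - v| ^+ 2.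
  rewrite /x -!(dot_norm) !(dotDl, dotDr, dotZl, dotZr, dotNl, dotNr) (dotC dot v w).
  by ring.
move: h; rewrite nx; set nw := `|w| ^+ 2; set nv := `|v| ^+ 2.
have : 0 <= `|w - v| ^+ 2 by exact: sqr_ge0.
set nd := `|w - v| ^+ 2 => nd0 h.
(* [om] may be negative, hence the absolute value in the constant. *)
have : om * (l * (1 - l) * nd) <= `|om| * (l * nd).
  apply: (@le_trans _ _ (`|om| * (l * (1 - l) * nd))).
    by apply: ler_wpM2r (ler_norm om); apply: mulr_ge0 => //; nra.
  by apply: ler_wpM2l => //; apply: ler_wpM2r => //; nra.
by nra.
Qed.

(** Chain rule in one direction: monotonicity of [Theta] turns the lower bound
    [E v + l q] of [E (v + l w)] into the lower bound [Theta (E v + l q)], which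
    is expanded to first order.  In particular, upper bounds of [E] along the
    ray, which may be infinite, are irrelevant. *)
Lemma subgradient_er_map (Theta : R -> R) (v f : H) (d : R) :
  {homo Theta : x y / x <= y} -> is_derive (fine (E v)) 1 Theta d ->
  subgradient dot E v f -> subgradient dot (er_map Theta \o E) v (d *: f).
Proof.
move=> Tnd /(@is_derive_epsP _ R^o) dT [Ev fE].
have Evf := dom_fin_num Ev; set r := fine (E v) in dT.
have E1 : E v = r%:E by rewrite fineK.
split; first by rewrite /dom/= E1/= ltry.
move=> w; apply: limf_einf_right_ge => e e0.
set p := dot f w.
have C0 : 0 < 2 * (`|d| + 1) by rewrite mulr_gt0// ltr_wpDl.
(* [e1] is the loss in the lower limit of the quotients of [E], multiplied by
   [d] in the end; [e2] is the error in the expansion of [Theta], multiplied by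
   [q].  Each of them accounts for [e / 2]. *)
pose e1 := e / (2 * (`|d| + 1)); have e10 : 0 < e1 by rewrite divr_gt0.
pose q := p - e1.
have D0 : 0 < 2 * (`|q| + 1) by rewrite mulr_gt0// ltr_wpDl.
pose e2 := e / (2 * (`|q| + 1)); have e20 : 0 < e2 by rewrite divr_gt0.
have [rho rho0 Hrho] := dT e2 e20.
have := near_limf_einf_right (fE w) e10.
have : \forall l \near (0:R)^'+, l < rho / (`|q| + 1).
  by apply: nbhs_right_lt; rewrite divr_gt0// ltr_wpDl.
have : \forall l \near (0:R)^'+, 0 < l by exact: nbhs_right_gt.
apply: filterS3 => l l0 lrho.
rewrite /= E1; set x := v + l *: w.
rewrite -/p -/q dotZl -/p.
have TE : (Theta (r + l * q))%:E = er_map Theta (r + l * q)%:E by [].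
move=> hq.
have hE : ((r + l * q)%:E <= E x)%E.
  move: hq; rewrite lee_pdivlMr// => hq.
  by rewrite EFinD addeC -leeBrDr//; apply: le_trans hq; rewrite -EFinM mulrC.
have hT : ((Theta (r + l * q))%:E <= er_map Theta (E x))%E.
  case: (E x) hE => [s| |] /=; first by rewrite !lee_fin; exact: Tnd.
    by move=> _; rewrite leey.
  by rewrite leeNy_eq.
rewrite lee_pdivlMr// leeBrDr// -EFinM -EFinD.
apply: le_trans hT; rewrite lee_fin.
have := Hrho (l * q); rewrite normrM (gtr0_norm l0).
have -> : l * `|q| < rho.
  move: lrho; rewrite ltr_pdivlMr ?ltr_wpDl// => lrho.
  by apply: le_lt_trans lrho; rewrite ler_wpM2l ?(ltW l0)// lerDl.
move=> /(_ isT); rewrite ler_norml => /andP[h _].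
rewrite /GRing.scale/= in h.
have h1 : e2 * `|q| <= e / 2.
  by rewrite /e2 mulrAC ler_pdivrMr//; lra.
have h2 : d * e1 <= e / 2.
  apply: (@le_trans _ _ (`|d| * e1)); first by apply: ler_wpM2r; rewrite ?ler_norm// ltW.
  by rewrite /e1 mulrA ler_pdivrMr//; lra.
have h3 := ler_wpM2l (ltW l0) h1; have h4 := ler_wpM2l (ltW l0) h2.
have -> : p = q + e1 by rewrite /q subrK.
by nra.
Qed.

(** The slope is an infimum over all subgradients, so it is bounded by the norm
    of [d *: f]. *)
Lemma slope_er_map_ge1 (Theta : R -> R) (v f : H) (d : R) :
  {homo Theta : x y / x <= y} -> is_derive (fine (E v)) 1 Theta d ->
  subgradient dot E v f -> (1 <= slope dot (er_map Theta \o E) v)%E ->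
  0 <= d /\ 1 <= d * `|f|.
Proof.
move=> Tnd dT fE sl.
have d0 : 0 <= d.
  rewrite leNgt; apply/negP => d0.
  have [] := (@is_derive_epsP _ R^o _ _ _).1 dT (- d / 2).
    by rewrite divr_gt0 ?oppr_gt0.
  move=> r r0 /(_ (r / 2)); rewrite gtr0_norm ?divr_gt0//.
  have -> : r / 2 < r by lra.
  move=> /(_ isT); rewrite ler_norml => /andP[_].
  have : Theta (fine (E v)) <= Theta (fine (E v) + r / 2).
    by apply: Tnd; rewrite lerDl divr_ge0// ltW.
  by rewrite /GRing.scale/=; nra.
split => //.
rewrite -lee_fin; apply: (le_trans sl); apply: ereal_inf_lbound.
exists (d *: f); first exact: subgradient_er_map.
by rewrite normrZ ger0_norm.
Qed.
End subgradient.

(** * Monotonicity from an almost everywhere condition *)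

(** A function whose difference quotients have the right sign almost everywhere
    need not be monotone (Cantor function); the bound of its increments by an
    integral excludes a singular part.  With [V] the indefinite integral of
    [v], the function [V - z] is nondecreasing with derivative at least [v]
    almost everywhere, hence its increments are at least those of [V]. *)
Lemma ae_nonincreasing (R : realType) (z v : R -> R) (a b : R) :
  mu.-integrable `]a, b[ (EFin \o v) -> (forall r, 0 <= v r) ->
  (forall s t, a < s -> s < t -> t < b -> z t - z s <= \int[mu]_(r in `]s, t]) v r) ->
  {ae mu, forall r, a < r < b -> forall e, 0 < e -> \forall n \near \oo,
    - e * n.+1%:R^-1 <= z (r - n.+1%:R^-1) - z r} ->
  forall s t, a < s -> s <= t -> t < b -> z t <= z s.
Proof.
move=> iv v0 zv aez s t as_ st tb.
have [V [VE dV]] := ae_is_derive_integral iv.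
pose G x := V x - z x.
have Gnd x y : s <= x -> x <= y -> y <= t -> G x <= G y.
  move=> sx; rewrite le_eqVlt => /orP[/eqP ->//|xy] yt.
  have ax := lt_le_trans as_ sx; have yb := le_lt_trans yt tb.
  rewrite /G; have := zv x y ax xy yb; rewrite -(VE x y (ltW ax) (ltW xy) yb); lra.
have : (\int[mu]_(r in `]s, t[) (v r)%:E <= (- G s - - G t)%:E)%E.
  apply: (@nonincreasing_integral_le _ (fun x => - G x) v s t st) => //.
  - by move=> x y sx xy yt; rewrite lerN2; exact: Gnd.
  - apply: measurable_funS (_ : measurable_fun `]a, b[ v) => //.
      by move=> x /=; rewrite !in_itv/= => /andP[? ?]; apply/andP; split;
        [exact: lt_trans as_ _|exact: lt_trans tb].
    by case/integrableP : iv => /measurable_EFinP.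
  - move: dV aez; apply: filterS2; first exact: (ae_filter_ringOfSetsType mu).
    move=> r dV zr /andP[sr rt] e e0.
    have rab : a < r < b by rewrite (lt_trans as_ sr) (lt_trans rt tb).
    have e20 : 0 < e / 2 by rewrite divr_gt0.
    have := zr rab _ e20; have := near_backward_quotient (dV rab) e20.
    apply: filterS2 => n h1 h2.
    have n0 : 0 < n.+1%:R :> R by [].
    rewrite mulrC -ler_pdivrMr// /G.
    move: h1; rewrite ler_norml /GRing.scale/= => /andP[_]; move: h2; move: (n.+1%:R^-1) => dl h2 h1; lra.
have -> : (\int[mu]_(r in `]s, t[) (v r)%:E = (V t - V s)%:E)%E.
  rewrite (VE s t (ltW as_) st tb) /Rintegral fineK; last first.
    apply: integrable_fin_num => //; apply: integrableS iv => //.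
    move=> x /=; rewrite !in_itv/= => /andP[? ?]; apply/andP; split.
      exact: lt_trans as_ _.
    exact: le_lt_trans tb.
  apply: integral_itv_bndo_bndc; apply/measurable_EFinP.
  apply: measurable_funS (_ : measurable_fun `]a, b[ v) => //.
    move=> x /=; rewrite !in_itv/= => /andP[? ?]; apply/andP; split.
      exact: lt_trans as_ _.
    exact: lt_trans tb.
  by case/integrableP : iv => /measurable_EFinP.
by rewrite lee_fin /G; lra.
Qed.

Lemma ae_exists_itv (R : realType) (P : R -> Prop) (a b : R) : a < b ->
  {ae mu, forall r, a < r < b -> P r} -> exists r, a < r < b /\ P r.
Proof.
move=> ab [N [mN N0 PN]]; apply: contrapT => nP.
have sub : `]a, b[ `<=` N.
  move=> r /=; rewrite in_itv/= => rab; apply: PN => /= H; apply: nP.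
  by exists r; split => //; exact: H.
have : (mu (`]a, b[%classic : set (measurableTypeR R)) <= mu N)%E.
  by apply: le_measure; rewrite ?inE//; exact: measurable_itv.
by rewrite N0 lebesgue_measure_itv/= lte_fin ab -EFinB lee_fin subr_le0 leNgt ab.
Qed.

Lemma ae_shift (R : realType) (P : R -> Prop) (c : R) :
  {ae mu, forall t, P t} -> {ae mu, forall t, P (t + c)}.
Proof.
move=> [N [mN N0 PN]]; exists ((fun t => t + c) @^-1` N); split.
- rewrite -[X in measurable X]setTI; exact: (measurable_shift c).
- by rewrite -N0; exact: lebesgue_measure_shift.
- by move=> t /= nP; exact: PN.
Qed.

Lemma integrable_shift (R : realType) (a b c : R) (v : R -> R) :
  measurable_fun setT v -> mu.-integrable `]a + c, b + c[ (EFin \o v) ->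
  mu.-integrable `]a, b[ (EFin \o (fun r => v (r + c))).
Proof.
move=> mv /integrableP[_ iv]; apply/integrableP; split.
  apply/measurable_EFinP; apply: measurable_funTS.
  exact: (measurableT_comp mv (measurable_shift c)).
have <- : (fun r => r + c) @^-1` `]a + c, b + c[ = `]a, b[%classic.
  by rewrite preimage_shift_itv !addrK.
have E := @ge0_integral_shift R c `]a + c, b + c[ (fun r => `|v r|%:E).
rewrite /= E//.
by apply/measurable_EFinP; apply: measurable_funTS; exact: measurableT_comp.
Qed.

Lemma Rintegral_shift (R : realType) (s t c : R) (v : R -> R) :
  measurable_fun setT v -> (forall r, 0 <= v r) ->
  \int[mu]_(r in `]s, t]) v (r + c) = \int[mu]_(r in `]s + c, t + c]) v r.
Proof.
move=> mv v0; rewrite /Rintegral; congr fine.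
have <- : (fun r => r + c) @^-1` `]s + c, t + c] = `]s, t]%classic.
  by rewrite preimage_shift_itv !addrK.
have E := @ge0_integral_shift R c `]s + c, t + c] (fun r => (v r)%:E).
rewrite -E//; last by move=> r _; rewrite lee_fin.
by apply/measurable_EFinP; exact: measurable_funTS.
Qed.

Lemma le_Rintegral_subset (R : realType) (A B : set (measurableTypeR R)) (v : R -> R) :
  measurable A -> measurable B -> A `<=` B -> mu.-integrable B (EFin \o v) ->
  (forall r, 0 <= v r) -> \int[mu]_(r in A) v r <= \int[mu]_(r in B) v r.
Proof.
move=> mA mB AB iv v0; rewrite /Rintegral; apply: fine_le.
- by apply: integrable_fin_num => //; exact: integrableS iv.
- exact: integrable_fin_num.
- apply: ge0_subset_integral => //.
    by case/integrableP : iv.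
  by move=> r _; rewrite lee_fin.
Qed.

(** * Energy dissipation along the flow *)

(** Only the following is used of the flow: [u] is dominated by the indefinite
    integral of [|g|], and almost every time is one at which [u] has
    the derivative [g] and the gradient system holds. *)
Section flow.
Context (R : realType) (H : normedModType R) (dot : {dot H for idfun}).
Hypothesis dot_norm : forall v : H, dot v v = `|v| ^+ 2.
Variables (E : H -> \bar R) (K : R).
Hypothesis E_proper : proper_functional E.
Hypothesis K0 : 0 <= K.
Hypothesis EK : forall v f, subgradient dot E v f -> forall w,
  ((fine (E v) + dot f (w - v) - K * `|w - v| ^+ 2)%:E <= E w)%E.
Variables (u g : R -> H).
Hypothesis mg : measurable_fun setT (fun t => `|g t|).
Hypothesis ig : forall T : R, 0 < T -> mu.-integrable `]0, T[ (EFin \o (fun t => `|g t|)).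
Hypothesis ug : forall s t : R, 0 < s -> s < t ->
  `|u t - u s| <= \int[mu]_(r in `]s, t]) `|g r|.
Let good (t : R) := is_derive t 1 u (g t) /\ subgradient dot E (u t) (- g t).
Hypothesis aeg : {ae mu, forall t : R, 0 < t -> good t}.

(** Sum of the two subgradient inequalities at [v] and at [w]. *)
Lemma subgradient_monotone (v w f k : H) :
  subgradient dot E v f -> subgradient dot E w k ->
  dot (f - k) (w - v) <= 2 * K * `|w - v| ^+ 2.
Proof.
move=> fv kw; have := EK fv w; have := EK kw v.
rewrite -{1}(fineK (dom_fin_num E_proper fv.1)) -{2}(fineK (dom_fin_num E_proper kw.1)).
rewrite !lee_fin -(normrN (v - w)) -[v - w]opprB opprK dotNr dotBl; lra.
Qed.

(** Two solutions of the flow separate at most like [exp (2Kt)], because [dE] is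
    monotone up to [2K]; the second solution is the translate of [u] by [e].
    The proof is [ae_nonincreasing] for
    [z r := exp (- 4Kr) |u (r + e) - u r|^2]. *)
Lemma increment_contraction (e s t : R) : 0 < e -> 0 < s -> s <= t ->
  `|u (t + e) - u t| <= expR (2 * K * (t - s)) * `|u (s + e) - u s|.
Proof.
move=> e0 s0 st.
pose b := t + 1; have tb : t < b by rewrite ltrDl.
have b0 : 0 < b by rewrite (lt_trans s0)// (le_lt_trans st).
pose D r := u (r + e) - u r.
pose M := \int[mu]_(r in `]0, b + e[) `|g r|.
have M0 : 0 <= M by apply: Rintegral_ge0.
have DM r : 0 < r -> r < b -> `|D r| <= M.
  move=> r0 rb; apply: (le_trans (ug r0 _)); first by rewrite ltrDl.
  apply: le_Rintegral_subset => //; last by apply: ig; rewrite addr_gt0.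
  by move=> x /=; rewrite !in_itv/= => /andP[? ?]; apply/andP; split; lra.
pose v r := 2 * M * (`|g (r + e)| + `|g r|).
have v0 r : 0 <= v r by rewrite !mulr_ge0// addr_ge0.
pose I : set (measurableTypeR R) := `]0, b[%classic.
have mI : measurable I by exact: measurable_itv.
have ig1 : mu.-integrable I (EFin \o (fun r => `|g r|)) by exact: ig.
have ig2 : mu.-integrable I (EFin \o (fun r => `|g (r + e)|)).
  apply: (integrable_shift mg); apply: integrableS (ig (addr_gt0 b0 e0)) => //.
    by move=> x /=; rewrite !in_itv/= => /andP[? ?]; apply/andP; split; lra.
have ig12 : mu.-integrable I (EFin \o (fun r => `|g (r + e)| + `|g r|)).
  by have := integrableD mI ig2 ig1; apply: eq_integrable.
have iv : mu.-integrable I (EFin \o v).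
  by have := integrableZl mI (2 * M) ig12; apply: eq_integrable.
pose z r := expR (- (4 * K * r)) * `|D r| ^+ 2.
have zincr r q : 0 < r -> r < q -> q < b -> z q - z r <= \int[mu]_(x in `]r, q]) v x.
  move=> r0 rq qb.
  have rI : (`]r, q]%classic : set (measurableTypeR R)) `<=` I.
    by move=> x /=; rewrite /I/= !in_itv/= => /andP[? ?]; apply/andP; split; lra.
  have mrq : measurable (`]r, q]%classic : set (measurableTypeR R)) by exact: measurable_itv.
  rewrite RintegralZl//; last by apply: integrableS ig12.
  rewrite RintegralD//; [|by apply: integrableS ig2|by apply: integrableS ig1].
  have -> : \int[mu]_(x in `]r, q]) `|g (x + e)| = \int[mu]_(x in `](r + e), (q + e)]) `|g x|.
    by apply: (@Rintegral_shift _ r q e (fun x => `|g x|)).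
  set J1 := Rintegral _ _ _; set J2 := Rintegral _ _ _.
  have d1 : `|u (q + e) - u (r + e)| <= J1 by apply: ug; lra.
  have d2 : `|u q - u r| <= J2 by exact: ug.
  have dD : `|D q| - `|D r| <= J1 + J2.
    apply: (le_trans (lerB_dist _ _)).
    have -> : D q - D r = (u (q + e) - u (r + e)) - (u q - u r).
      by rewrite /D !opprB addrACA [in RHS]addrACA [- u q + _]addrC.
    by apply: (le_trans (ler_normB _ _)); exact: lerD.
  have E1 : 0 < expR (- (4 * K * r)) <= 1.
    by rewrite expR_gt0 -expR0 ler_expR oppr_le0 !mulr_ge0// ltW.
  have E2 : expR (- (4 * K * q)) <= expR (- (4 * K * r)).
    by rewrite ler_expR lerN2 ler_wpM2l ?mulr_ge0// ltW.
  have J10 : 0 <= J1 by exact: Rintegral_ge0.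
  have J20 : 0 <= J2 by exact: Rintegral_ge0.
  have Dq := DM q (lt_trans r0 rq) qb; have Dr := DM r r0 (lt_trans rq qb).
  move: E1 E2 dD Dq Dr (normr_ge0 (D q)) (normr_ge0 (D r)); rewrite /z.
  set A := expR (- (4 * K * q)); set B := expR (- (4 * K * r)); set p := `|D q|; set p' := `|D r|.
  move=> /andP[B0 B1] AB dD pM p'M p0 p'0.
  have h1 : A * p ^+ 2 <= B * p ^+ 2 by rewrite ler_wpM2r ?sqr_ge0//.
  have h2 : p ^+ 2 - p' ^+ 2 <= 2 * M * (J1 + J2).
    rewrite subr_sqr; apply: (@le_trans _ _ ((J1 + J2) * (p + p'))).
      by apply: ler_wpM2r => //; rewrite addr_ge0.
    by rewrite mulrC ler_wpM2r ?addr_ge0//; lra.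
  have J : 0 <= 2 * M * (J1 + J2) by rewrite !mulr_ge0// addr_ge0.
  have h3 : B * (p ^+ 2 - p' ^+ 2) <= 2 * M * (J1 + J2).
    apply: (le_trans (ler_wpM2l (ltW B0) h2)); exact: ler_piMl.
  lra.
have zquot : {ae mu, forall r, 0 < r < b -> forall eta, 0 < eta -> \forall n \near \oo,
    - eta * n.+1%:R^-1 <= z (r - n.+1%:R^-1) - z r}.
  move: (aeg) (ae_shift e aeg); apply: filterS2; first exact: (ae_filter_ringOfSetsType mu).
  move=> r gr gre /andP[r0 _] eta eta0.
  have [dr fr] := gr r0; have [dre fre] := gre (addr_gt0 r0 e0).
  have mon := subgradient_monotone fr fre.
  set D' := g (r + e) - g r.
  have {}mon : dot (D r) D' <= 2 * K * `|D r| ^+ 2.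
    by move: mon; rewrite opprK addrC -/D' dotC.
  set m := `|D r| in mon; have m0 : 0 <= m by exact: normr_ge0.
  have mp : 0 < m + 1 by rewrite ltr_wpDl.
  have Kp : 0 < 1 + 4 * K by rewrite ltr_pwDl// mulr_ge0.
  have C0 : 0 < 8 * (m + 1) * (1 + 4 * K) by rewrite !mulr_gt0.
  (* Write [dl] for the step.  Then [z (r - dl) - z r] is bounded below by an
   expression with two error terms besides [- eta * dl]: the differentiability
   error, controlled by [e1], and a term of order [dl^2], which is
   controlled by the restriction on [dl]. *)
pose e1 := eta / (8 * (m + 1) * (1 + 4 * K)).
  have e10 : 0 < e1 by rewrite divr_gt0.
  have C20 : 0 < 2 * (16 * K ^+ 2 * m ^+ 2 + 1).
    by rewrite mulr_gt0// ltr_wpDl// !mulr_ge0// sqr_ge0.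
  have : \forall n \near \oo, n.+1%:R^-1 <= Num.min 1 (eta / (2 * (16 * K ^+ 2 * m ^+ 2 + 1))).
    apply: (@cvgr_le _ _ _ _ _ _ (@cvg_harmonic R)).
    by rewrite lt_min ltr01/= divr_gt0.
  move: (near_backward_quotient dr e10) (near_backward_quotient dre e10).
  apply: filterS3 => n.
  have : 0 < n.+1%:R^-1 :> R by rewrite invr_gt0.
  move: (n.+1%:R^-1) => dl dl0 q1 q2; rewrite le_min => /andP[dl1 dl2].
  have q3 : `|D (r - dl) - D r + dl *: D'| <= 2 * e1 * dl.
    have -> : D (r - dl) - D r + dl *: D' =
      (u (r + e - dl) - u (r + e) + dl *: g (r + e)) - (u (r - dl) - u r + dl *: g r).
      rewrite /D /D' scalerBr [r - dl + e]addrAC !opprD !opprK.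
      by rewrite [RHS]addrACA; congr (_ + _); rewrite [RHS]addrACA.
    by apply: (le_trans (ler_normB _ _)); lra.
  (* Expansion of [|D (r - dl)|^2] with [X = D (r - dl) - D r], which is
     [- dl D'] up to [2 e1 dl]; the square of [X] is discarded. *)
  have y1 : m ^+ 2 - 4 * K * dl * m ^+ 2 - 4 * e1 * dl * m <= `|D (r - dl)| ^+ 2.
    have -> : D (r - dl) = D r + (D (r - dl) - D r) by rewrite addrCA subrr addr0.
    rewrite (norm2D dot_norm (D r) (D (r - dl) - D r)) -/m.
    set X := D (r - dl) - D r in q3 *.
    have -> : dot (D r) X = dot (D r) (X + dl *: D') - dl * dot (D r) D'.
      by rewrite (dotDr dot X (dl *: D') (D r)) (dotZr dot dl D' (D r)) addrK.
    have := norm_dot_le dot_norm (D r) (X + dl *: D'); rewrite ler_norml => /andP[h _].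
    have h2 := ler_wpM2l m0 q3; rewrite -/m in h.
    have h3 := ler_wpM2l (ltW dl0) mon.
    have := sqr_ge0 `|X|; lra.
  have Ee : expR (- (4 * K * (r - dl))) = expR (- (4 * K * r)) * expR (4 * K * dl).
    by rewrite -expRD; congr expR; ring.
  have Ed : 1 + 4 * K * dl <= expR (4 * K * dl) by exact: expR_ge1Dx.
  have E0 : 0 < expR (- (4 * K * r)) <= 1.
    by rewrite expR_gt0 -expR0 ler_expR oppr_le0 !mulr_ge0// ltW.
  rewrite /z Ee -/m; move: E0 Ed.
  set B := expR (- (4 * K * r)); set C := expR (4 * K * dl) => /andP[B0 B1] Ed.
  set y := `|D (r - dl)| ^+ 2 in y1 *; have yge0 : 0 <= y by exact: sqr_ge0.
  have Kd0 : 0 <= 4 * K * dl by rewrite !mulr_ge0// ltW.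
  have s1 : (1 + 4 * K * dl) * y <= C * y by rewrite ler_wpM2r.
  have s2 : (1 + 4 * K * dl) * (m ^+ 2 - 4 * K * dl * m ^+ 2 - 4 * e1 * dl * m) <=
      (1 + 4 * K * dl) * y by rewrite ler_wpM2l//; lra.
  have t1 : 16 * K ^+ 2 * m ^+ 2 * dl <= eta / 2.
    move: dl2; rewrite ler_pdivlMr// => dl2.
    have : 0 <= dl * 2 by lra.
    lra.
  have t2 : 4 * e1 * m * (1 + 4 * K * dl) <= eta / 2.
    have h : (1 + 4 * K * dl) <= 1 + 4 * K.
      by rewrite lerD2l -[leRHS]mulr1 ler_wpM2l// mulr_ge0.
    have h2 : e1 * (8 * (m + 1) * (1 + 4 * K)) = eta by rewrite /e1 divfK// gt_eqF.
    have h3 : 4 * e1 * m * (1 + 4 * K * dl) <= 4 * e1 * m * (1 + 4 * K).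
      by apply: ler_wpM2l h; apply: mulr_ge0 => //; apply: mulr_ge0 => //; exact: ltW.
    have h4 : 0 <= e1 * (1 + 4 * K) by rewrite mulr_ge0 ?(ltW e10)//; lra.
    lra.
  have key : m ^+ 2 - C * y <= eta * dl.
    have h1 := ler_wpM2l (ltW dl0) t1; have h2 := ler_wpM2l (ltW dl0) t2.
    have s3 := le_trans s2 s1.
    apply: (@le_trans _ _ (m ^+ 2 - (1 + 4 * K * dl) * (m ^+ 2 - 4 * K * dl * m ^+ 2 - 4 * e1 * dl * m))).
      by rewrite lerD2l lerN2.
    lra.
  have ed0 : 0 <= eta * dl by rewrite mulr_ge0// ltW.
  have : B * (m ^+ 2 - C * y) <= eta * dl.
    apply: (le_trans (ler_wpM2l (ltW B0) key)); exact: ler_piMl.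
  by rewrite -mulrA; lra.
have := ae_nonincreasing iv v0 zincr zquot s0 st tb.
rewrite -/(D t) -/(D s) /z => zts.
rewrite -(@ler_pXn2r _ 2)// ?nnegrE ?mulr_ge0 ?expR_ge0//.
rewrite exprMn -expRM_natl.
have -> : expR (2%:R * (2 * K * (t - s))) = expR (4 * K * t) * expR (- (4 * K * s)).
  by rewrite -expRD; congr expR; ring.
have h := ler_wpM2l (expR_ge0 (4 * K * t)) zts.
rewrite mulrA -expRD subrr expR0 mul1r mulrA in h.
exact: h.
Qed.

(** [increment_contraction] divided by the step and passed to the limit. *)
Lemma good_norm_le (s t : R) : 0 < s -> s <= t -> good s -> good t ->
  `|g t| <= expR (2 * K * (t - s)) * `|g s|.
Proof.
move=> s0 st [/is_derive_epsP ds _] [/is_derive_epsP dt _].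
set C := expR _; have C0 : 0 < C by exact: expR_gt0.
apply/ler_addgt0Pr => e e0.
pose e1 := e / (1 + C); have C1 : 0 < 1 + C by rewrite addr_gt0.
have e10 : 0 < e1 by rewrite divr_gt0.
have [r1 r10 H1] := ds _ e10; have [r2 r20 H2] := dt _ e10.
pose h := Num.min r1 r2 / 2.
have m0 : 0 < Num.min r1 r2 by rewrite lt_min r10.
have h0 : 0 < h by rewrite divr_gt0.
have hlt : h < Num.min r1 r2 by rewrite /h ltr_pdivrMr// ltr_pMr// ltr1n.
move: hlt; rewrite lt_min => /andP[hr1 hr2].
have := H1 h; have := H2 h; rewrite gtr0_norm// => /(_ hr2) q2 /(_ hr1) q1.
have c := increment_contraction h0 s0 st; rewrite -/C in c.
have a1 : h * `|g t| <= `|u (t + h) - u t| + e1 * h.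
  have -> : h * `|g t| = `|h *: g t| by rewrite normrZ gtr0_norm.
  have -> : h *: g t = (u (t + h) - u t) - (u (t + h) - u t - h *: g t).
    by rewrite opprB addrCA subrr addr0.
  by apply: (le_trans (ler_normB _ _)); rewrite lerD2l.
have a2 : `|u (s + h) - u s| <= h * `|g s| + e1 * h.
  have -> : h * `|g s| = `|h *: g s| by rewrite normrZ gtr0_norm.
  have -> : u (s + h) - u s = h *: g s + (u (s + h) - u s - h *: g s).
    by rewrite addrCA subrr addr0.
  by apply: (le_trans (ler_normD _ _)); rewrite lerD2l.
have a3 := ler_wpM2l (ltW C0) a2.
rewrite -(ler_pM2l h0); have -> : e = e1 * (1 + C) by rewrite /e1 divfK// gt_eqF.
by move: (`|g t|) (`|g s|) (`|u (t + h) - u t|) (`|u (s + h) - u s|) a1 a2 a3 c => *; lra.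
Qed.

(** The bound of [|g|] on [[a, b]] comes from a single time [s] before [a] by
    [good_norm_le]; this is the regularising effect of the flow. *)
Lemma locally_lipschitz (a b : R) : 0 < a -> exists2 M : R, 0 <= M &
  (forall t, a <= t <= b -> good t -> `|g t| <= M) /\
  (forall s t, a <= s -> s <= t -> t <= b -> `|u t - u s| <= M * (t - s)).
Proof.
move=> a0.
have [s [/andP[s1 sa] gs]] : exists s, a / 2 < s < a /\ good s.
  apply: ae_exists_itv; first lra.
  move: aeg; apply: filterS; first exact: (ae_filter_ringOfSetsType mu).
  by move=> r gr /andP[r1 r2]; apply: gr; lra.
have s0 : 0 < s by lra.
pose M := expR (2 * K * (b - s)) * `|g s|.
have M0 : 0 <= M by rewrite mulr_ge0// expR_ge0.
have gM t : a <= t <= b -> good t -> `|g t| <= M.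
  move=> /andP[at_ tb] gt_; apply: (le_trans (good_norm_le s0 _ gs gt_)); first lra.
  rewrite ler_wpM2r// ler_expR ler_wpM2l ?mulr_ge0//; lra.
exists M => //; split => // r t ar; rewrite le_eqVlt => /orP[/eqP ->|rt] tb.
  by rewrite !subrr normr0 mulr0.
apply: (le_trans (ug _ rt)); first lra.
pose D : set (measurableTypeR R) := `]r, t]%classic.
have mD : measurable D by exact: measurable_itv.
have muD : mu D = (t - r)%:E by rewrite /D lebesgue_measure_itv/= lte_fin rt.
have iD : mu.-integrable D (EFin \o (fun t => `|g t|)).
  apply: integrableS (ig (_ : 0 < t + 1)) => //; last lra.
  by move=> x /=; rewrite /D/= !in_itv/= => /andP[? ?]; apply/andP; split; lra.
rewrite -lee_fin /Rintegral fineK; last exact: integrable_fin_num.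
apply: (@le_trans _ _ (\int[mu]_(x in D) (cst M%:E x))%E).
  apply: ae_ge0_le_integral => //.
  - by case/integrableP : iD.
  - move: aeg; apply: filterS; first exact: (ae_filter_ringOfSetsType mu).
    move=> x gx; rewrite /D/= in_itv/= => /andP[rx xt]; rewrite lee_fin; apply: gM; first lra.
    by apply: gx; lra.
by rewrite integral_cst//; move: muD => /= ->; rewrite EFinM.
Qed.

Hypothesis E_lsc : lower_semicontinuous E.

Lemma continuous_flow (t : R) : 0 < t -> {for t, continuous u}.
Proof.
move=> t0; have [M M0 [_ uM]] := @locally_lipschitz (t / 2) (t + 1) (divr_gt0 t0 (ltr0Sn _ _)).
apply/cvgrPdist_le => e e0.
have M1 : 0 < M + 1 by lra.
exists (Num.min (e / (M + 1)) (Num.min 1 (t / 2))).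
  by rewrite /= !lt_min ltr01/= (divr_gt0 e0 M1) divr_gt0.
move=> x /=; rewrite !lt_min => /and3P[x1 x2 x3].
move: x1; rewrite ltr_pdivlMr// => x1.
move: x2 x3; rewrite !ltr_norml => /andP[? ?] /andP[? ?].
have key : `|u t - u x| <= M * `|t - x|.
  have [xt|tx] := leP x t.
    by rewrite [`|t - x|]ger0_norm ?subr_ge0//; apply: uM => //; lra.
  rewrite distrC [`|t - x|]distrC [`|x - t|]gtr0_norm ?subr_gt0//; apply: uM; lra.
have := normr_ge0 (t - x); lra.
Qed.

(** If [t] is a time at which the system holds, then this is the subgradient
    inequality at [u t] evaluated at [u s].  Every other [t] is a limit of such
    times from the left, and lower semicontinuity bounds [E (u t)] by their
    energies. *)
Lemma energy_upper (a b : R) : 0 < a -> exists2 C : R, 0 <= C &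
  forall s t, a <= s -> s <= t -> t <= b -> (E (u t) <= E (u s) + (C * (t - s))%:E)%E.
Proof.
move=> a0; have [M M0 [gM uM]] := @locally_lipschitz a b a0.
pose C := M * M + K * M * M * `|b - a|.
have C0 : 0 <= C by rewrite addr_ge0 ?mulr_ge0.
have goodC s t : a <= s -> s <= t -> t <= b -> good t ->
    (E (u t) <= E (u s) + (C * (t - s))%:E)%E.
  move=> as_ st tb gt_; have Et := dom_fin_num E_proper gt_.2.1.
  rewrite -leeBlDr// -(fineK Et) -EFinB.
  apply: le_trans (EK gt_.2 (u s)); rewrite lee_fin.
  have d1 := uM s t as_ st tb.
  have d2 := gM t _ gt_; rewrite (le_trans as_ st) tb in d2.
  have {}d2 := d2 isT.
  rewrite dotNl -dotNr opprB distrC.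
  have := norm_dot_le dot_norm (g t) (u t - u s); rewrite ler_norml => /andP[h _].
  have d3 : `|g t| * `|u t - u s| <= M * (M * (t - s)) by apply: ler_pM.
  have d4 : `|u t - u s| ^+ 2 <= (M * (t - s)) ^+ 2.
    by rewrite ler_pXn2r ?nnegrE ?mulr_ge0 ?subr_ge0 ?normr_ge0.
  have d5 := ler_wpM2l K0 d4.
  have d6 : K * (M * (t - s)) ^+ 2 <= K * M * M * `|b - a| * (t - s).
    have -> : K * (M * (t - s)) ^+ 2 = K * M * M * (t - s) * (t - s) by ring.
    rewrite ler_wpM2r ?subr_ge0// ler_wpM2l ?mulr_ge0//.
    by apply: le_trans (ler_norm _); lra.
  move: h d3 d5; rewrite /C dotBr.
  by lra.
exists C => // s t as_; rewrite le_eqVlt => /orP[/eqP <-|st] tb.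
  by rewrite subrr mulr0 adde0.
rewrite leNgt; apply/negP => lt_.
have Es : E (u s) \is a fin_num.
  rewrite fin_numE E_proper.1/=; apply: contraTneq lt_ => ->.
  by rewrite addye// ltNge leey.
have [V Vt HV] : exists2 V, nbhs (u t) V &
    forall y, V y -> (E (u s) + (C * (t - s))%:E < E y)%E.
  by move: lt_; rewrite -(fineK Es) -EFinD; exact: E_lsc.
have /continuous_flow : 0 < t by lra.
move=> /(_ _ Vt) [d /= d0 Hd].
(* A time between [s] and [t] at which the system holds, so close to [t] that
   the energy still exceeds the bound. *)
pose q := Num.max s (t - d).
have qt : q < t by rewrite /q gt_max st ltrBlDr ltrDl.
have [r [/andP[qr rt] gr]] : exists r, q < r < t /\ good r.
  apply: ae_exists_itv => //.
  move: aeg; apply: filterS; first exact: (ae_filter_ringOfSetsType mu).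
  by move=> r gr /andP[]; rewrite gt_max => /andP[? ?] ?; apply: gr; lra.
move: qr; rewrite gt_max => /andP[sr dr].
have : V (u r) by apply: Hd => /=; rewrite ger0_norm; lra.
move=> /HV; apply/negP; rewrite -leNgt.
apply: (le_trans (goodC s r _ _ _ gr)); rewrite ?(ltW sr) ?(ltW rt)//.
  by lra.
by apply: leeD2l; rewrite lee_fin ler_wpM2l//; lra.
Qed.

Lemma energy_fin_num (t : R) : 0 < t -> E (u t) \is a fin_num.
Proof.
move=> t0.
have [s [/andP[s0 st] gs]] : exists s, 0 < s < t /\ good s.
  apply: ae_exists_itv => //.
  move: aeg; apply: filterS; first exact: (ae_filter_ringOfSetsType mu).
  by move=> r gr /andP[r0 _]; exact: gr.
have [C C0 EC] := @energy_upper s t s0.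
apply: dom_fin_num => //; rewrite /dom/=.
apply: (le_lt_trans (EC s t _ _ _)) => //; first exact: ltW.
by rewrite lte_add_pinfty ?ltry//; exact: gs.2.1.
Qed.

Let h (t : R) := fine (E (u t)).

Lemma energy_lipschitz_upper (a b : R) : 0 < a -> exists2 C : R, 0 <= C &
  forall s t, a <= s -> s <= t -> t <= b -> h t <= h s + C * (t - s).
Proof.
move=> a0; have [C C0 EC] := @energy_upper a b a0; exists C => // s t as_ st tb.
have Es := @energy_fin_num s (lt_le_trans a0 as_).
have Et := @energy_fin_num t (lt_le_trans a0 (le_trans as_ st)).
by rewrite -lee_fin EFinD /h !fineK//; exact: EC.
Qed.

Lemma good_energy_ge (r w : R) : 0 < w -> good r ->
  h r - dot (g r) (u w - u r) - K * `|u w - u r| ^+ 2 <= h w.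
Proof.
move=> w0 gr; have := EK gr.2 (u w).
by rewrite -{1}(fineK (energy_fin_num w0)) lee_fin dotNl.
Qed.

(** The subgradient inequality at [u r] evaluated at [u (r - 1/n)], where
    [u (r - 1/n) - u r] is [- g r / n] to first order. *)
Lemma near_good_energy_quotient (r : R) : 0 < r -> good r -> forall e, 0 < e ->
  \forall n \near \oo,
    (`|g r| ^+ 2 - e) * n.+1%:R^-1 <= h (r - n.+1%:R^-1) - h r.
Proof.
move=> r0 gr e e0; set m := `|g r|; have m0 : 0 <= m by exact: normr_ge0.
(* [e1] is the differentiability error: multiplied by [m] it is at most
   [e / 2], and being at most 1 it bounds the quotient of [u] by [m + 1].  The
   other half of [e] absorbs the quadratic term [K |X|^2]. *)
pose e1 := Num.min 1 (e / (2 * (m + 1))).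
have mp : 0 < 2 * (m + 1) by lra.
have e10 : 0 < e1 by rewrite lt_min ltr01 divr_gt0.
pose L := K * (m + 1) ^+ 2; have L0 : 0 <= L by rewrite mulr_ge0// sqr_ge0.
have : \forall n \near \oo, n.+1%:R^-1 <= Num.min (r / 2) (e / (2 * (L + 1))).
  apply: (@cvgr_le _ _ _ _ _ _ (@cvg_harmonic R)).
  by rewrite lt_min !divr_gt0//; lra.
have := near_backward_quotient gr.1 e10; apply: filterS2 => n.
have : 0 < n.+1%:R^-1 :> R by rewrite invr_gt0.
move: (n.+1%:R^-1) => d d0 q; rewrite le_min => /andP[d1 d2].
have := @good_energy_ge r (r - d) _ gr; set X := u (r - d) - u r in q *.
have -> : 0 < r - d by lra.
move=> /(_ isT) hr.
have e1m : e1 * m <= e / 2.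
  have h1 : e1 <= e / (2 * (m + 1)) by rewrite ge_min lexx orbT.
  apply: (le_trans (ler_wpM2r m0 h1)).
  by rewrite mulrAC ler_pdivrMr//; nra.
have e11 : e1 <= 1 by rewrite ge_min lexx.
have xn : `|X| <= (m + 1) * d.
  have -> : X = (X + d *: g r) - d *: g r by rewrite addrK.
  apply: (le_trans (ler_normB _ _)); rewrite normrZ gtr0_norm// -/m.
  have : e1 * d <= d by rewrite ler_piMl// ltW.
  lra.
have x2 : `|X| ^+ 2 <= ((m + 1) * d) ^+ 2.
  by rewrite ler_pXn2r ?nnegrE ?normr_ge0// mulr_ge0 ?ltW//; lra.
have Kx : K * `|X| ^+ 2 <= e / 2 * d.
  apply: (le_trans (ler_wpM2l K0 x2)).
  have -> : K * ((m + 1) * d) ^+ 2 = L * d * d by rewrite /L; ring.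
  rewrite ler_wpM2r ?(ltW d0)//.
  by move: d2; rewrite ler_pdivlMr; lra.
have dx : dot (g r) X <= - (d * m ^+ 2) + e / 2 * d.
  have -> : dot (g r) X = dot (g r) (X + d *: g r) - d * m ^+ 2.
    by rewrite (dotDr dot X (d *: g r) (g r)) (dotZr dot d (g r) (g r)) dot_norm addrK.
  have := dot_le_norm dot_norm (g r) (X + d *: g r); rewrite -/m => h1.
  have h2 := ler_wpM2l m0 q.
  have h3 := ler_wpM2r (ltW d0) e1m.
  by lra.
by lra.
Qed.

(** The energy is not known to be nonincreasing yet, but by
    [energy_lipschitz_upper] it becomes so after subtraction of [C r], and this
    linear function has the same contribution to both sides. *)
Lemma energy_inequality (s t : R) : 0 < s -> s <= t ->
  (\int[mu]_(r in `]s, t[) (`|g r| ^+ 2)%:E <= (h s - h t)%:E)%E.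
Proof.
move=> s0 st; have [C C0 hC] := @energy_lipschitz_upper s t s0.
pose D : set (measurableTypeR R) := `]s, t[%classic.
have mD : measurable D by exact: measurable_itv.
have muD : mu D = (t - s)%:E.
  rewrite /D lebesgue_measure_itv/= lte_fin; case: ltP => // ts.
  by rewrite (@le_anti _ _ s t) ?st// subrr.
have mg2 : measurable_fun D (fun r => `|g r| ^+ 2).
  by apply: measurable_funTS; exact: measurable_funX.
have : (\int[mu]_(r in D) (`|g r| ^+ 2 + C)%:E <= ((h s - C * s) - (h t - C * t))%:E)%E.
  apply: (@nonincreasing_integral_le _ (fun r => h r - C * r)) => //.
  - by move=> x y sx xy yt; have := hC x y sx xy yt; lra.
  - by apply: measurable_funD => //; exact: measurable_cst.
  - by move=> x _; rewrite addr_ge0// sqr_ge0.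
  move: aeg; apply: filterS; first exact: (ae_filter_ringOfSetsType mu).
  move=> r gr /andP[sr rt] e e0; have r0 : 0 < r by lra.
  have := near_good_energy_quotient r0 (gr r0) e0; apply: filterS => n.
  have n0 : 0 < n.+1%:R :> R by [].
  rewrite -ler_pdivlMr ?invr_gt0// invrK => q.
  rewrite -subr_ge0; move: q; rewrite -subr_ge0.
  have -> : n.+1%:R * (h (r - n.+1%:R^-1) - C * (r - n.+1%:R^-1) - (h r - C * r)) =
     (h (r - n.+1%:R^-1) - h r) * n.+1%:R + C * (n.+1%:R^-1 * n.+1%:R) by ring.
  by rewrite mulVf ?gt_eqF// mulr1; lra.
under eq_integral do rewrite EFinD.
rewrite ge0_integralD//; do ?[exact/measurable_EFinP|
  by move=> x _; rewrite lee_fin ?sqr_ge0].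
rewrite integral_cst//; move: muD => /= ->.
rewrite -EFinM -leeBrDr// -EFinB => /le_trans; apply.
by rewrite lee_fin; lra.
Qed.

Lemma energy_nonincreasing (s t : R) : 0 < s -> s <= t -> h t <= h s.
Proof.
move=> s0 st; rewrite -subr_ge0 -lee_fin; apply: le_trans (energy_inequality s0 st).
by apply: integral_ge0 => r _; rewrite lee_fin sqr_ge0.
Qed.

Lemma near_energy_le (r : R) : 0 < r ->
  \forall n \near \oo, h r <= h (r - n.+1%:R^-1).
Proof.
move=> r0; have : \forall n \near \oo, n.+1%:R^-1 < r :> R.
  exact: (@cvgr_lt _ _ _ _ _ _ (@cvg_harmonic R)).
apply: filterS => n nr; apply: energy_nonincreasing; first by rewrite subr_gt0.
by rewrite lerBlDr lerDl invr_ge0.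
Qed.

Lemma increment_le_length (s t : R) : 0 < s -> s <= t ->
  (`|u t - u s|%:E <= \int[mu]_(r in `]s, t[) `|g r|%:E)%E.
Proof.
move=> s0; rewrite le_eqVlt => /orP[/eqP <-|st].
  by rewrite subrr normr0 integral_ge0// => r _; rewrite lee_fin.
have i1 : mu.-integrable `]s, t] (EFin \o (fun t => `|g t|)).
  apply: integrableS (ig (_ : 0 < t + 1)) => //; last lra.
  by move=> x /=; rewrite !in_itv/= => /andP[? ?]; apply/andP; split; lra.
have := ug s0 st; rewrite -lee_fin /Rintegral fineK; last exact: integrable_fin_num.
rewrite -(integral_itv_bndo_bndc (a := BRight s))//.
by apply/measurable_EFinP; exact: measurable_funTS.
Qed.

(** Cauchy-Schwarz for the integral of [|g|]. *)
Lemma increment_sq_le (s t : R) : 0 < s -> s <= t ->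
  `|u t - u s| ^+ 2 <= (t - s) * (h s - h t).
Proof.
move=> s0; rewrite le_eqVlt => /orP[/eqP <-|st].
  by rewrite !subrr normr0 mul0r expr0n.
pose D : set (measurableTypeR R) := `]s, t[%classic.
have mD : measurable D by exact: measurable_itv.
have muD : mu D = (t - s)%:E by rewrite /D lebesgue_measure_itv/= lte_fin st.
have ts0 : 0 < t - s by rewrite subr_gt0.
have mg2 : measurable_fun D (fun r => `|g r| ^+ 2).
  by apply: measurable_funTS; exact: measurable_funX.
have mgD : measurable_fun D (fun r => `|g r|) by exact: measurable_funTS.
have En := energy_inequality s0 (ltW st).
have u1 := increment_le_length s0 (ltW st).
set x := `|u t - u s| in u1 *.
have x0 : 0 <= x by exact: normr_ge0.
(* [2 c |g| <= |g|^2 + c^2] is integrated; this [c], the mean value that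
   corresponds to [x], is the optimal one. *)
pose c := x / (t - s); have c0 : 0 <= c by rewrite divr_ge0// ltW.
have : ((2 * c * x)%:E <= (h s - h t + c ^+ 2 * (t - s))%:E)%E.
  rewrite EFinM; apply: (@le_trans _ _ (\int[mu]_(r in D) (2 * c * `|g r|)%:E)%E).
    under [leRHS]eq_integral do rewrite EFinM.
    rewrite ge0_integralZl//; last by rewrite lee_fin; exact: mulr_ge0.
      by apply: lee_pmul => //; rewrite lee_fin//; exact: mulr_ge0.
    exact/measurable_EFinP.
  apply: (@le_trans _ _ (\int[mu]_(r in D) (`|g r| ^+ 2 + c ^+ 2)%:E)%E).
    apply: le_nonneg_integral => r _; rewrite lee_fin; first by apply: mulr_ge0 => //; exact: mulr_ge0.
    by have := sqr_ge0 (`|g r| - c); lra.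
  under eq_integral do rewrite EFinD.
  rewrite ge0_integralD//; do ?[exact/measurable_EFinP|
    by move=> r _; rewrite lee_fin ?sqr_ge0].
  rewrite integral_cst//; move: muD => /= ->.
  by rewrite -EFinM EFinD; apply: leeD2r.
rewrite lee_fin; have cx : c * (t - s) = x by rewrite /c divfK// gt_eqF.
move=> q; have := ler_wpM2r (ltW ts0) q.
have -> : 2 * c * x * (t - s) = 2 * x * (c * (t - s)) by ring.
have -> : (h s - h t + c ^+ 2 * (t - s)) * (t - s) =
  (t - s) * (h s - h t) + (c * (t - s)) ^+ 2 by ring.
by rewrite cx; lra.
Qed.

(** A critical point is at rest: over a short time [d] the energy drops by at
    most [K |u (r + d) - u r|^2], while this square is at most [d] times the
    drop. *)
Lemma good_critical (r : R) : 0 < r -> good r -> subgradient dot E (u r) 0 -> g r = 0.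
Proof.
move=> r0 gr z0.
have zero : forall d, 0 < d -> K * d < 1 -> u (r + d) - u r = 0.
  move=> d d0 Kd; have rd0 : 0 < r + d by lra.
  have := EK z0 (u (r + d)); rewrite dotC dot0r addr0 -{1}(fineK (energy_fin_num rd0)) lee_fin.
  rewrite -/(h r) -/(h _) => k1.
  have := @increment_sq_le r (r + d) r0 _; rewrite lerDl (ltW d0) => /(_ isT).
  rewrite [r + d - r]addrAC subrr add0r => k2.
  apply/eqP; rewrite -normr_eq0 -sqrf_eq0 eq_le sqr_ge0 andbT.
  set x := `|_| ^+ 2 in k1 k2 *.
  have x0 : 0 <= x by exact: sqr_ge0.
  have := ler_wpM2l (ltW d0) (_ : h r - h (r + d) <= K * x); rewrite lerBlDr => k3.
  have {}k3 : d * (h r - h (r + d)) <= d * (K * x) by apply: k3; lra.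
  have : (1 - K * d) * x <= 0 by lra.
  by rewrite pmulr_rle0// subr_gt0.
apply/eqP; rewrite -normr_le0; apply/ler_addgt0Pr => e e0; rewrite add0r.
have /is_derive_epsP/(_ e e0)[rho rho0 Hrho] := gr.1.
pose d := Num.min (rho / 2) (1 / (2 * (K + 1))).
have Kp : 0 < 2 * (K + 1) by have := K0; lra.
have d0 : 0 < d by rewrite lt_min !divr_gt0.
have d1 : d < rho by rewrite gt_min; apply/orP; left; lra.
have d2 : K * d < 1.
  have : d <= 1 / (2 * (K + 1)) by rewrite ge_min lexx orbT.
  rewrite ler_pdivlMr// => ?; have := ltW d0; lra.
have := Hrho d; rewrite gtr0_norm// => /(_ d1).
by rewrite zero// sub0r normrN normrZ gtr0_norm// mulrC ler_pM2r.
Qed.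

(** [h] is monotone on [`]0, +oo[] only, and [hc] is its constant extension. *)
Let hc (a b r : R) := h (Num.max a (Num.min r b)).

Lemma measurable_energy (a b : R) : 0 < a -> a <= b -> measurable_fun `]a, b[ h.
Proof.
move=> a0 ab; apply: (eq_measurable_fun (hc a b)).
  move=> r; rewrite inE/= in_itv/= => /andP[ar rb].
  by rewrite /hc (min_idPl (ltW rb)) (max_idPr (ltW ar)).
apply: measurable_funTS; apply: nonincreasing_measurable => // x y xy.
apply: energy_nonincreasing; first by rewrite lt_max a0.
rewrite ge_max le_max lexx/= le_max; apply/orP; right.
by rewrite le_min !ge_min xy lexx !orbT.
Qed.

(** For an open [U] containing [N] of measure at most [eta], let [q x] be the
    measure of [U] below [x].  It has slope 1 on [U], and so [q o h] has
    backward quotients at least [|g|^2] at the times with energy in [N], while its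
    total drop is at most [eta].  Hence [|g|^2] has integral at most [eta] over
    these times, for every [eta]. *)
Lemma ae_energy_notin_null (N : set (measurableTypeR R)) (a b : R) :
  measurable N -> mu N = 0 -> 0 < a -> a <= b ->
  {ae mu, forall r, a < r < b -> N (h r) -> g r = 0}.
Proof.
move=> mN N0 a0 ab.
pose D : set (measurableTypeR R) := `]a, b[%classic.
have mD : measurable D by exact: measurable_itv.
pose A := D `&` h @^-1` N.
have mA : measurable A by exact: (measurable_energy a0 ab).
pose f r := `|g r| ^+ 2 * \1_A r.
have f0 r : 0 <= f r by rewrite mulr_ge0// ?sqr_ge0// indicE.
have mf : measurable_fun D f.
  apply: measurable_funM; apply: measurable_funTS; first exact: measurable_funX.
  exact: measurable_indic.
have int_small (eta : R) : 0 < eta -> (\int[mu]_(r in D) (f r)%:E <= eta%:E)%E.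
  move=> eta0.
  have [U [oU NU mUN]] : exists U : set R,
      [/\ open U, N `<=` U & (mu (U `\` N) < eta%:E)%E].
    have Noo : (mu N < +oo)%E by rewrite N0 ltry.
    exact: (lebesgue_regularity_outer mN Noo eta0).
  have mU : measurable (U : set (measurableTypeR R)) by exact: open_measurable.
  have muU : (mu U <= eta%:E)%E.
    have UE : N `|` (U `\` N) = U by rewrite setDUK.
    have mUN' : measurable (U `\` N : set (measurableTypeR R)) by exact: measurableD.
    have := measureU2 mu mN mUN'; rewrite UE => /le_trans; apply.
    by move: N0 => /= ->; rewrite add0e ltW.
  pose Q (x : R) : set (measurableTypeR R) := U `&` `]-oo, x].
  have mQ x : measurable (Q x) by apply: measurableI => //; exact: measurable_itv.
  have Qeta x : (mu (Q x) <= eta%:E)%E.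
    apply: le_trans muU; apply: le_measure; rewrite ?inE//; exact: subIsetl.
  have Qfin x : mu (Q x) \is a fin_num.
    by rewrite ge0_fin_numE// (le_lt_trans (Qeta x))// ltry.
  pose q x := fine (mu (Q x)).
  have qnd x y : x <= y -> q x <= q y.
    move=> xy; apply: fine_le => //; apply: le_measure; rewrite ?inE//.
    by move=> z [Uz /=]; rewrite !in_itv/= => zx; split => //=; rewrite in_itv/= (le_trans zx).
  have q0 x : 0 <= q x by rewrite fine_ge0.
  have qeta x : q x <= eta by rewrite -lee_fin /q fineK.
  have qincr x y : x <= y -> (`]x, y] `<=` U) -> q x + (y - x) <= q y.
    move=> xy xyU; pose J : set (measurableTypeR R) := `]x, y]%classic.
    have mJ : measurable J by exact: measurable_itv.
    have muJ : mu J = (y - x)%:E.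
      rewrite /J lebesgue_measure_itv/= lte_fin; case: ltP => // yx.
      by rewrite (@le_anti _ _ x y) ?xy// subrr.
    rewrite -lee_fin EFinD /q !fineK// -muJ -measureU//.
      apply: le_measure; rewrite ?inE//; first exact: measurableU.
      move=> z [[Uz]|Jz]; first by rewrite /= in_itv/= => zx; split => //=; rewrite in_itv/= (le_trans zx).
      split; first exact: xyU.
      by move: Jz; rewrite /J/= !in_itv/= => /andP[].
    rewrite -subset0 => z [[_ /=]]; rewrite /J/= !in_itv/= => zx /andP[xz _].
    by rewrite ltNge zx in xz.
  have := @nonincreasing_integral_le _ (fun r => q (h r)) f a b ab.
  move=> /(_ _ mf _ _)/le_trans; apply.
  - move=> x y ax xy yb; apply: qnd; apply: energy_nonincreasing => //; exact: lt_le_trans ax.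
  - by move=> x _; exact: f0.
  - move: aeg; apply: filterS; first exact: (ae_filter_ringOfSetsType mu).
    move=> r gr /andP[ar rb] e e0; have r0 : 0 < r by rewrite (lt_trans a0).
    have mono := near_energy_le r0.
    have triv : f r - e <= 0 -> \forall n \near \oo,
        f r - e <= n.+1%:R * (q (h (r - n.+1%:R^-1)) - q (h r)).
      move=> fe; move: mono; apply: filterS => n hn.
      by rewrite (le_trans fe)// mulr_ge0// subr_ge0 qnd.
    have [fe|fe] := leP (f r) e; first by apply: triv; rewrite subr_le0.
    have Ar : A r.
      apply: contrapT => nA; move: fe; rewrite /f indicE memNset// mulr0.
      by rewrite ltNge ltW.
    have fE : f r = `|g r| ^+ 2 by rewrite /f indicE mem_set// mulr1.
    have [rho /= rho0 Hrho] : nbhs (h r) U.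
      by apply: open_nbhs_nbhs; split => //; apply: NU; exact: Ar.2.
    have c0 : 0 < f r - e by rewrite subr_gt0.
    have : \forall n \near \oo, n.+1%:R^-1 < rho / (f r - e) :> R.
      by apply: (@cvgr_lt _ _ _ _ _ _ (@cvg_harmonic R)); rewrite divr_gt0.
    have := near_good_energy_quotient r0 (gr r0) e0; rewrite -fE.
    apply: filterS2 => n hn; rewrite ltr_pdivlMr// => nrho.
    rewrite mulrC -ler_pdivrMr//.
    have d0 : 0 < n.+1%:R^-1 :> R by rewrite invr_gt0.
    move: (n.+1%:R^-1) d0 hn nrho => d d0 hn nrho.
    have := qincr (h r) (h r + (f r - e) * d) _ _.
    rewrite lerDl mulr_ge0 ?(ltW d0) ?(ltW c0)// => /(_ isT) Hq.
    rewrite lerBrDl; apply: le_trans (qnd _ _ (_ : h r + (f r - e) * d <= _)); last by lra.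
    apply: le_trans (Hq _); first by rewrite lerD2l addrAC subrr add0r.
    move=> z; rewrite /= in_itv/= => /andP[z1 z2]; apply: Hrho => /=.
    rewrite ltr0_norm ?subr_lt0// opprB; lra.
  by rewrite lee_fin; have := q0 (h b); have := qeta (h a); lra.
have int0 : (\int[mu]_(r in D) `|(f r)%:E| = 0)%E.
  under eq_integral do rewrite gee0_abs ?lee_fin//.
  apply/eqP; rewrite eq_le integral_ge0 ?andbT; last by move=> r _; rewrite lee_fin.
  by apply/lee_addgt0Pr => e e0; rewrite add0e; exact: int_small.
have mfE : measurable_fun D (EFin \o f) by exact/measurable_EFinP.
have [M [mM M0 fM]] := (ae_eq_integral_abs mu mD mfE).1 int0.
exists M; split => // r /= nr; apply: fM => /= fr; apply: nr => rab Nr.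
have Dr : D r by rewrite /D/= in_itv.
have := fr Dr; rewrite /= /f indicE mem_set ?mulr1; last by split.
by move=> /(congr1 fine)/= /eqP; rewrite sqrf_eq0 normr_eq0 => /eqP.
Qed.

(** The backward quotients of [Theta o h] are at least
    [Theta'(h) |g|^2 >= |g|] where [Theta] is differentiable at the energy, and
    the remaining times have [g = 0] almost everywhere. *)
Lemma length_le (Theta : R -> R) (s t : R) :
  {homo Theta : x y / x <= y} ->
  {ae mu, forall x, exists d, is_derive (x : R) 1 Theta d} ->
  0 < s -> s <= t ->
  (forall r, s < r < t -> ~ subgradient dot E (u r) 0 ->
    (1 <= slope dot (er_map Theta \o E) (u r))%E) ->
  (\int[mu]_(r in `]s, t[) `|g r|%:E <= (Theta (h s) - Theta (h t))%:E)%E.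
Proof.
move=> Tnd [N [mN N0 NT]] s0 st KL.
apply: (@nonincreasing_integral_le _ (fun r => Theta (h r)) (fun r => `|g r|)) => //.
- by move=> x y sx xy yt; apply: Tnd; apply: energy_nonincreasing => //; exact: lt_le_trans sx.
- exact: measurable_funTS.
move: aeg (ae_energy_notin_null mN N0 s0 st); apply: filterS2.
  exact: (ae_filter_ringOfSetsType mu).
move=> r gr Nr rst e e0; have [sr rt] := andP rst.
have r0 : 0 < r by exact: lt_trans sr.
have {}gr := gr r0; have {}Nr := Nr rst.
have mono := near_energy_le r0.
have [g0|g0] := eqVneq (g r) 0.
  move: mono; apply: filterS => n hn; rewrite g0 normr0 sub0r.
  by apply: (@le_trans _ _ 0); [rewrite oppr_le0 ltW|rewrite mulr_ge0// subr_ge0 Tnd].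
have [d dT] : exists d, is_derive (h r) 1 Theta d.
  apply: contrapT => nd; move/eqP: g0; apply; apply: Nr; exact: NT.
have [d0 dg] : 0 <= d /\ 1 <= d * `|- g r|.
  apply: (slope_er_map_ge1 E_proper Tnd dT gr.2); apply: KL => //.
  by move=> z0; move/eqP: g0; apply; exact: good_critical.
rewrite normrN in dg; set m := `|g r| in dg *.
have m0 : 0 <= m by exact: normr_ge0.
(* [e1] is the error in the quotient of the energy, multiplied by the
   derivative [d] in the end, and [e2] is the one in the expansion of [Theta],
   whose increment is at most [m^2 + 1] times the step.  Each of them accounts
   for [e / 2]. *)
pose e1 := Num.min 1 (e / (2 * (d + 1))).
have dp : 0 < 2 * (d + 1) by lra.
have e10 : 0 < e1 by rewrite lt_min ltr01 divr_gt0.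
have e11 : e1 <= 1 by rewrite ge_min lexx.
have de1 : d * e1 <= e / 2.
  have q : e1 <= e / (2 * (d + 1)) by rewrite ge_min lexx orbT.
  apply: (le_trans (ler_wpM2l d0 q)); rewrite mulrA ler_pdivrMr//; nra.
have mm : 0 < 2 * (m ^+ 2 + 1) by have := sqr_ge0 m; lra.
pose e2 := e / (2 * (m ^+ 2 + 1)); have e20 : 0 < e2 by rewrite divr_gt0.
have [rho rho0 Hrho] := (@is_derive_epsP _ R^o _ _ _).1 dT e2 e20.
have : \forall n \near \oo, n.+1%:R^-1 < rho / (m ^+ 2 + 1) :> R.
  by apply: (@cvgr_lt _ _ _ _ _ _ (@cvg_harmonic R)); rewrite divr_gt0//; lra.
have := near_good_energy_quotient r0 gr e10; rewrite -/m.
apply: filterS2 => n hn; rewrite ltr_pdivlMr; last by lra.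
move=> nrho; rewrite mulrC -ler_pdivrMr//.
have dl0 : 0 < n.+1%:R^-1 :> R by rewrite invr_gt0.
move: (n.+1%:R^-1) dl0 hn nrho => dl dl0 hn nrho.
set p := m ^+ 2 - e1 in hn.
have pm : `|p| <= m ^+ 2 + 1.
  by rewrite ler_norml /p; have := sqr_ge0 m; lra.
have hT : Theta (h r + p * dl) <= Theta (h (r - dl)) by apply: Tnd; lra.
have := Hrho (p * dl); rewrite normrM (gtr0_norm dl0).
have -> : `|p| * dl < rho.
  by apply: le_lt_trans nrho; rewrite mulrC ler_wpM2l// ltW.
move=> /(_ isT); rewrite ler_norml /GRing.scale/= => /andP[q _].
have q2 : e2 * (`|p| * dl) <= e / 2 * dl.
  rewrite mulrA ler_wpM2r ?(ltW dl0)//.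
  apply: (le_trans (ler_wpM2l (ltW e20) pm)).
  by rewrite /e2 mulrAC ler_pdivrMr//; lra.
have q3 : m <= d * m ^+ 2.
  by rewrite expr2 mulrA; apply: ler_peMl.
have q4 := ler_wpM2r (ltW dl0) q3; have q5 := ler_wpM2r (ltW dl0) de1.
by rewrite /p in q hT; lra.
Qed.

(** * Convergence to an omega-limit point *)

Section omega_limit_point.
Variables (phi : H) (tn : nat -> R).
Hypotheses (phi_dom : dom E phi) (tn_oo : tn n @[n --> \oo] --> +oo)
  (u_phi : u (tn n) @[n --> \oo] --> phi).
Let e0 := fine (E phi).

Let near_tn (T e : R) : 0 < e -> \forall n \near \oo, T < tn n /\ `|u (tn n) - phi| <= e.
Proof.
move=> ep; move/cvgrPdist_le: u_phi => /(_ e ep); have := tn_oo => /cvgryPgt/(_ T).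
by apply: filterS2 => n nT ne; split => //; rewrite distrC.
Qed.

Lemma energy_limit_le (t : R) : 0 < t -> e0 <= h t.
Proof.
move=> t0; rewrite leNgt; apply/negP => lt_.
have [V Vphi HV] : exists2 V, nbhs phi V & forall y, V y -> ((h t)%:E < E y)%E.
  by apply: E_lsc; rewrite -(fineK (dom_fin_num E_proper phi_dom)) lte_fin.
have cV : \forall n \near \oo, V (u (tn n)) by exact: u_phi.
have [n [Vn [nt _]]] := filter_ex (filterI cV (near_tn t ltr01)).
have nt0 : 0 < tn n by exact: lt_trans nt.
have := HV _ Vn; rewrite -(fineK (energy_fin_num nt0)) lte_fin ltNge.
by rewrite energy_nonincreasing// ltW.
Qed.

(** Late drops of the energy over unit time are at most [d^2], so shortly after
    some [tn n] there is a time [s] with [|g s| <= 2d] and [u s] within [2d] of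
    [phi].  The subgradient inequality at [u s] evaluated at [phi] then yields
    [h s <= E phi + O(d^2)], and monotonicity keeps this for later times. *)
Lemma energy_limit_ge (e : R) : 0 < e -> exists2 T : R, 0 < T &
  forall t, T <= t -> h t <= e0 + e.
Proof.
move=> ep.
pose d := Num.min 1 (e / (8 * (K + 1))).
have Kp : 0 < 8 * (K + 1) by have := K0; lra.
have d0 : 0 < d by rewrite lt_min ltr01 divr_gt0.
have d1 : d <= 1 by rewrite ge_min lexx.
have dK : d * (8 * (K + 1)) <= e.
  by rewrite -ler_pdivlMr// ge_min lexx orbT.
have [T T0 HT] : exists2 T : R, 0 < T & forall t, T <= t -> h t - h (t + 1) <= d ^+ 2.
  pose A := [set h t | t in [set t | 0 < t]].
  have hA : has_inf A.
    split; first by exists (h 1), 1 => //=.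
    by exists e0 => _ [t /= t0 <-]; exact: energy_limit_le.
  have [_ [T /= T0 <-] hT] := inf_adherent (exprn_gt0 2 d0) hA.
  exists T => // t Tt; have t0 := lt_le_trans T0 Tt.
  have h1 := energy_nonincreasing T0 Tt.
  have h2 : inf A <= h (t + 1).
    by apply: ge_inf; [exact: hA.2|exists (t + 1) => //=; lra].
  lra.
have [n [nT nphi]] := filter_ex (near_tn T d0).
set t := tn n in nT nphi; have t0 : 0 < t by exact: lt_trans nT.
(* If [|g|] were larger than [2d] on the whole unit interval, the energy would
   drop by [4d^2]. *)
have [s [/andP[ts st] gs gsd]] : exists s, [/\ t < s < t + 1, good s & `|g s| <= 2 * d].
  apply: contrapT => nex.
  have aed : {ae mu, forall r, t < r < t + 1 -> 2 * d <= `|g r|}.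
    move: aeg; apply: filterS; first exact: (ae_filter_ringOfSetsType mu).
    move=> r gr rt; rewrite leNgt; apply/negP => gd; apply: nex; exists r; split => //.
      by apply: gr; case/andP: rt => rt _; exact: lt_trans rt.
    exact: ltW.
  pose D : set (measurableTypeR R) := `]t, (t + 1)[%classic.
  have mD : measurable D by exact: measurable_itv.
  have muD : mu D = 1%:E.
    by rewrite /D lebesgue_measure_itv/= lte_fin ltrDl ltr01 -EFinB addrAC subrr add0r.
  have : (\int[mu]_(r in D) (cst ((2 * d) ^+ 2)%:E r) <= (h t - h (t + 1))%:E)%E.
    apply: le_trans (energy_inequality t0 _); last by rewrite lerDl.
    apply: ae_ge0_le_integral => //.
    - by move=> r _; rewrite lee_fin sqr_ge0.
    - apply/measurable_EFinP; apply: measurable_funTS; exact: measurable_funX.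
    - move: aed; apply: filterS; first exact: (ae_filter_ringOfSetsType mu).
      move=> r gr; rewrite /D/= in_itv/= => rt; rewrite lee_fin.
      by rewrite ler_pXn2r ?nnegrE ?normr_ge0 ?gr// mulr_ge0// ltW.
  rewrite integral_cst//; move: muD => /= ->; rewrite mule1 lee_fin.
  have := HT t (ltW nT); have := exprn_gt0 2 d0; lra.
exists (t + 1); first lra.
move=> r tr; apply: (le_trans (energy_nonincreasing _ tr)); first lra.
apply: (le_trans (energy_nonincreasing _ (ltW st))); first lra.
have s0 : 0 < s by lra.
have us : `|u s - u t| <= d.
  rewrite -(@ler_pXn2r _ 2) ?nnegrE ?normr_ge0 ?(ltW d0)//.
  apply: (le_trans (increment_sq_le t0 (ltW ts))).
  have h1 := HT t (ltW nT); have h2 := energy_nonincreasing s0 (ltW st).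
  have h3 := energy_nonincreasing t0 (ltW ts).
  apply: (@le_trans _ _ (1 * (h t - h s))); last lra.
  by apply: ler_wpM2r; lra.
have up : `|phi - u s| <= 2 * d.
  rewrite distrC; have -> : u s - phi = (u s - u t) + (u t - phi).
    by rewrite addrA subrK.
  by apply: (le_trans (ler_normD _ _)); lra.
have := EK gs.2 phi; rewrite -{1}(fineK (dom_fin_num E_proper phi_dom)) lee_fin -/e0 -/(h s).
rewrite dotNl; set x := phi - u s in up *.
have := dot_le_norm dot_norm (g s) x.
have n1 : `|g s| * `|x| <= 2 * d * (2 * d) by apply: ler_pM.
have n2 : `|x| ^+ 2 <= (2 * d) ^+ 2.
  by rewrite ler_pXn2r ?nnegrE ?normr_ge0// mulr_ge0// ltW.
have n3 := ler_wpM2l K0 n2.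
have n4 : 4 * d * d * (K + 1) <= e.
  have : d * (d * (8 * (K + 1))) <= 1 * (d * (8 * (K + 1))).
    by apply: ler_wpM2r => //; rewrite mulr_ge0// ltW.
  have : 0 <= d * d * (K + 1) by rewrite !mulr_ge0 ?(ltW d0)//; have := K0; lra.
  lra.
by lra.
Qed.

Variables (Theta : R -> R) (delta : R).
Hypotheses (Theta_nd : {homo Theta : x y / x <= y}) (Theta_cont : continuous Theta)
  (Theta_der : {ae mu, forall x, exists d, is_derive (x : R) 1 Theta d})
  (delta0 : 0 < delta)
  (KL : forall v, dom E v -> `|v - phi| < delta -> `|fine (E v) - e0| < delta ->
    ~ subgradient dot E v 0 -> (1 <= slope dot (er_map Theta \o E) v)%E).

Let length_le_near (s t : R) : 0 < s -> s <= t -> h s < e0 + delta ->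
  (forall r, s < r < t -> `|u r - phi| < delta) ->
  (\int[mu]_(r in `]s, t[) `|g r|%:E <= (Theta (h s) - Theta (h t))%:E)%E.
Proof.
move=> s0 st hs ball; apply: length_le => // r rst; have /andP[sr rt] := rst.
have r0 : 0 < r by exact: lt_trans sr.
apply: KL; [by have := energy_fin_num r0; rewrite fin_numE /dom/= ltey => /andP[]|exact: ball|].
have h1 := energy_limit_le r0; have h2 := energy_nonincreasing s0 (ltW sr).
rewrite -/(h r) ger0_norm; lra.
Qed.

(** The time [s = tn n] is chosen with [|u s - phi|] and
    [Theta (h s) - Theta (E phi)] at most [delta / 3].  Up to the first exit
    time from the ball of radius [delta] the path is at most [delta / 3] long,
    so it stays within [2 delta / 3] of [phi] and there is no exit.  From then
    on the length is bounded by the drop of [Theta o h], and the distance to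
    [phi] is estimated in the same manner from later [tn m]. *)
Lemma flow_converges :
  [/\ exists2 s : R, 0 < s & (\int[mu]_(r in `]s, +oo[) `|g r|%:E < +oo)%E,
    u t @[t --> +oo] --> phi & forall e, 0 < e ->
      \forall t \near +oo, `|h t - e0| <= e].
Proof.
have hcvg e : 0 < e -> exists2 T, 0 < T & forall t, T <= t -> `|h t - e0| <= e.
  move=> ep; have [T T0 HT] := energy_limit_ge ep; exists T => // t Tt.
  have := HT t Tt; have := energy_limit_le (lt_le_trans T0 Tt).
  by move=> h1 h2; rewrite ger0_norm; lra.
have Tcvg e : 0 < e -> exists2 T, 0 < T & forall t, T <= t -> Theta (h t) - Theta e0 <= e.
  move=> ep; have /cvgrPdist_le/(_ e ep)[r /= r0 Hr] := @Theta_cont e0.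
  have [T T0 HT] := @hcvg (r / 2) (divr_gt0 r0 (ltr0Sn _ _)).
  exists T => // t Tt; apply: (le_trans (ler_norm _)); rewrite distrC; apply: Hr => /=.
  rewrite distrC; apply: (le_lt_trans (HT t Tt)); lra.
have d3 : 0 < delta / 3 by rewrite divr_gt0.
have [T1 T10 HT1] := hcvg _ d3; have [T2 T20 HT2] := Tcvg _ d3.
have [n [nT nphi]] := filter_ex (near_tn (Num.max T1 T2) d3).
move: nT nphi; set s := tn n; rewrite gt_max => /andP[s1 s2] sphi.
have s0 : 0 < s by exact: lt_trans s1.
have hs : h s < e0 + delta.
  have := HT1 s (ltW s1); rewrite ler_norml => /andP[_ ?]; lra.
have Ts := HT2 s (ltW s2).
have Tlow t : 0 < t -> Theta e0 <= Theta (h t).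
  by move=> t0; apply: Theta_nd; exact: energy_limit_le.
have trap t1 : s <= t1 -> `|u t1 - phi| < delta.
  move=> st1; rewrite ltNge; apply/negP => out.
  (* The supremum of [A] is the first exit time. *)
  pose A := [set t | s <= t <= t1 /\ forall r, s <= r <= t -> `|u r - phi| < delta].
  have As : A s.
    split; first by rewrite lexx.
    move=> r rs; have -> : r = s by apply/eqP; rewrite eq_le andbC.
    by apply: (le_lt_trans sphi); lra.
  have ubA : ubound A t1 by move=> t [/andP[]].
  have supA : has_sup A by split; [exists s|exists t1].
  pose T := sup A.
  have sT : s <= T by apply: sup_ubound => //; exact: supA.2.
  have Tt1 : T <= t1 by apply: ge_sup => //; exists s.
  have below r : s <= r -> r < T -> `|u r - phi| < delta.
    move=> sr rT; have [t [_ At] rt] := sup_gt (ex_intro _ s As) rT.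
    by apply: At; rewrite sr ltW.
  have T0 : 0 < T by exact: lt_le_trans sT.
  have uT : `|u T - phi| < delta.
    have L : (`|u T - u s|%:E <= (delta / 3)%:E)%E.
      apply: (le_trans (increment_le_length s0 sT)).
      apply: (le_trans (length_le_near s0 sT hs _)).
        by move=> r /andP[sr rT]; apply: below => //; exact: ltW.
      by rewrite lee_fin; have := Tlow T T0; lra.
    rewrite lee_fin in L.
    have -> : u T - phi = (u T - u s) + (u s - phi) by rewrite addrA subrK.
    by apply: (le_lt_trans (ler_normD _ _)); lra.
  have [rho /= rho0 Hrho] : \forall x \near T, `|u x - phi| < delta.
    have /cvgrPdist_lt/(_ (delta - `|u T - phi|)) := continuous_flow T0.
    rewrite subr_gt0 => /(_ uT); apply: filterS => x.
    have -> : u x - phi = (u x - u T) + (u T - phi) by rewrite addrA subrK.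
    by rewrite distrC => q; apply: (le_lt_trans (ler_normD _ _)); lra.
  have after r : s <= r -> r < T + rho -> `|u r - phi| < delta.
    move=> sr rr; have [rT|Tr] := ltP r T; first exact: below.
    by apply: Hrho => /=; rewrite ler0_norm ?subr_le0// opprB; lra.
  have [tr|rt] := ltP t1 (T + rho).
    by have := after t1 st1 tr; rewrite ltNge out.
  have AT : A (T + rho / 2).
    split; first by apply/andP; split; lra.
    by move=> r /andP[sr rr]; apply: after => //; lra.
  have : T + rho / 2 <= T by apply: sup_ubound => //; exact: supA.2.
  by lra.
have len r t : s <= r -> r <= t ->
    (\int[mu]_(x in `]r, t[) `|g x|%:E <= (Theta (h r) - Theta (h t))%:E)%E.
  move=> sr rt; have r0 := lt_le_trans s0 sr; apply: length_le_near => //.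
    by apply: le_lt_trans hs; exact: energy_nonincreasing.
  by move=> x /andP[rx _]; apply: trap; rewrite (le_trans sr)// ltW.
split.
- exists s => //; apply: (@le_lt_trans _ _ (Theta (h s) - Theta e0)%:E); last by rewrite ltry.
  pose F (n : nat) : set (measurableTypeR R) := `]s, (s + n%:R)[%classic.
  have FE : \bigcup_n F n = `]s, +oo[%classic.
    apply/seteqP; split => x.
      by move=> [m _]; rewrite /F/= !in_itv/= => /andP[->].
    rewrite /= in_itv/= andbT => sx; exists (Num.truncn (x - s)).+1 => //.
    rewrite /F/= in_itv/= sx/= -ltrBlDl.
    have xs : 0 <= x - s by rewrite subr_ge0 ltW.
    by have /andP[] := truncn_itv xs.
  have Fnd : {homo F : m k / (m <= k)%N >-> (m <= k)%O}.
    move=> m k mk; apply/subsetPset => x; rewrite /F/= !in_itv/= => /andP[-> xm]/=.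
    by rewrite (lt_le_trans xm)// lerD2l ler_nat.
  have mF k : measurable (F k) by exact: measurable_itv.
  have := @ge0_nondecreasing_set_cvg_integral _ _ R F (fun r => `|g r|%:E) mu Fnd mF.
  rewrite FE => cvF.
  have mFg k : measurable_fun (F k) (fun r => `|g r|%:E).
    by apply/measurable_EFinP; exact: measurable_funTS.
  apply: (cvge_to_le (cvF mFg _)); first by move=> k x _; rewrite lee_fin.
  near=> k; apply: (le_trans (len s (s + k%:R) (lexx _) _)); first by rewrite lerDl.
  by rewrite lee_fin lerD2l lerN2 Tlow// ltr_wpDr.
- apply/cvgrPdist_le => e ep; have e2 : 0 < e / 2 by rewrite divr_gt0.
  have [T3 T30 HT3] := Tcvg _ e2.
  have [m [mT mphi]] := filter_ex (near_tn (Num.max s T3) e2).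
  move: mT; rewrite gt_max => /andP[m1 m2].
  near=> t; rewrite distrC.
  have tm : tn m <= t by near: t; apply: nbhs_pinfty_ge; exact: num_real.
  have m0 : 0 < tn m by exact: lt_trans m1.
  have -> : u t - phi = (u t - u (tn m)) + (u (tn m) - phi) by rewrite addrA subrK.
  apply: (le_trans (ler_normD _ _)).
  have := le_trans (increment_le_length m0 tm) (len _ _ (ltW m1) tm).
  rewrite lee_fin; have := HT3 _ (ltW m2); have := Tlow t (lt_le_trans m0 tm); lra.
- move=> e ep; have [T T0 HT] := hcvg e ep.
  by near=> t; apply: HT; near: t; apply: nbhs_pinfty_ge; exact: num_real.
Unshelve. all: by end_near. Qed.
End omega_limit_point.
End flow.

(** * The desingularising function and the energy topology *)

(** On each interval a function in [W^(1,1)] is the indefinite integral of its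
    derivative, and Lebesgue differentiation applies; countably many intervals
    suffice. *)
Lemma W11loc_ae_is_derive (R : realType) (Theta : R -> R) : W11loc Theta ->
  {ae mu, forall x, exists d, is_derive (x : R) 1 Theta d}.
Proof.
move=> [cT [dT HT]].
have local (a b : R) : a < b ->
    {ae mu, forall x, a < x < b -> exists d, is_derive (x : R) 1 Theta d}.
  move=> ab; have [_ [sm idT] wk] := HT a b ab.
  pose D : set (measurableTypeR R) := `]a, b[%classic.
  have mD : measurable D by exact: measurable_itv.
  have [N [mN N0 mdT _]] := strongly_measurable_comp mD sm.
  (* A Borel representative of the derivative. *)
  pose th (x : R) : R := if x \in D `\` N then dT x else 0.
  have mDN : measurable (D `\` N) by exact: measurableD.
  have mth : measurable_fun D th.
    have -> : D = (D `\` N) `|` (D `&` N) by rewrite setUC setUIDK.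
    apply/measurable_funU => //; first exact: measurableI.
    split.
      apply: (eq_measurable_fun dT); first by move=> x xDN; rewrite /th xDN.
      by apply: (mdT (fun y => y)) => x; exact: cvg_id.
    apply: (eq_measurable_fun (cst (0 : R))) => [x|]; last exact: measurable_cst.
    rewrite inE => -[_ Nx].
    by rewrite /th memNset// => -[_].
  have ith : mu.-integrable D (EFin \o th).
    apply/integrableP; split; first exact/measurable_EFinP.
    apply: le_lt_trans idT; apply: le_nonneg_integral => x _ //=.
    by rewrite expr1 lee_fin /th; case: ifP => // _; rewrite normr0.
  have [V [VE dV]] := ae_is_derive_integral ith.
  have aeth : {ae mu, forall t, a < t < b -> th t = idfun (dT t)}.
    exists N; split => // t /= /not_implyP[tab]; apply: contra_notP => Nt.
    by rewrite /th mem_set//; split => //; rewrite /D/= in_itv.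
  have TE : forall s t, a < s -> s < t -> t < b ->
      Theta t - Theta s = \int[mu]_(x in `]s, t]) th x.
    apply: (@weak_derivative_functional R R^o a b 1 idfun Theta dT th _ _ _ _ wk ith aeth) => //.
    by move=> x; rewrite mul1r.
  move: dV; apply: filterS; first exact: (ae_filter_ringOfSetsType mu).
  move=> x dV /andP[ax xb]; exists (th x).
  have {dV} := dV; rewrite ax xb => /(_ isT) /(@is_derive_epsP _ R^o) dV.
  apply/(@is_derive_epsP _ R^o) => e e0; have [r r0 Hr] := dV e e0.
  exists (Num.min r (Num.min (x - a) (b - x))).
    by rewrite !lt_min r0 !subr_gt0 ax.
  move=> k; rewrite !lt_min => /and3P[kr]; rewrite !ltr_norml => /andP[k1 _] /andP[_ k2].
  have -> : Theta (x + k) - Theta x = V (x + k) - V x.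
    have [k0|k0|->] := ltgtP k 0; last by rewrite addr0 !subrr.
    - rewrite -[LHS]opprB -[RHS]opprB; congr (- _).
      by rewrite TE; [rewrite VE//; lra|lra|lra|lra].
    - by rewrite TE; [rewrite VE//; lra|lra|lra|lra].
  exact: Hr.
have : {ae mu, forall x, forall n : nat, - n.+1%:R < x < n.+1%:R ->
    exists d, is_derive (x : R) 1 Theta d}.
  by apply: ae_foralln => n; apply: local; rewrite gtrN.
apply: filterS; first exact: (ae_filter_ringOfSetsType mu).
move=> x Hx; apply: (Hx (Num.truncn `|x|)).
rewrite -ltr_norml; by have /andP[] := truncn_itv (normr_ge0 x).
Qed.

Lemma initial_nbhsP (S : choiceType) (T : topologicalType) (f : S -> T)
    (x : initial_topology f) (U : set (initial_topology f)) :
  nbhs x U <-> exists2 B : set T, nbhs (f x) B & f @^-1` B `<=` U.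
Proof.
split=> [|[B Bx BU]].
  rewrite nbhsE => -[W [[B oB <-] Wx] WU]; exists B; last exact: WU.
  by exists B.
by apply: filterS BU _; exact: (@initial_continuous _ _ f x B Bx).
Qed.

(** Neighbourhoods in the energy topology are those of the pair formed by the
    point and its energy. *)
Lemma tau_nbhsP (R : realType) (H : normedModType R) (E : H -> \bar R)
    (phi : tau E) (U : set (tau E)) :
  nbhs phi U <-> exists2 d : R, 0 < d & forall v : H, dom E v ->
    `|v - tau_val phi| < d ->
    `|fine (E v) - fine (E (tau_val phi))| < d -> (@tau_val R H E @` U) v.
Proof.
pose f (v : dom E) : H * R^o := (set_val v, fine (E (set_val v))).
split=> [/initial_nbhsP[B [[B1 B2] /= [HB1 HB2] B12] BU]|[d d0 HU]].
  move/nbhs_normP: HB1 => [d1 /= d10 H1]; move/nbhs_normP: HB2 => [d2 /= d20 H2].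
  exists (Num.min d1 d2); first by rewrite lt_min d10.
  move=> v Ev; rewrite !lt_min => /andP[v1 _] /andP[_ v2].
  exists (exist _ v (mem_set Ev) : dom E) => //.
  apply: BU; apply: B12; split => /=.
    by apply: H1; rewrite /ball_/= distrC.
  by apply: H2; rewrite /ball_/= distrC.
apply/initial_nbhsP; exists [set p : H * R^o |
    `|p.1 - tau_val phi| < d /\ `|p.2 - fine (E (tau_val phi))| < d].
  exists ([set v | `|v - tau_val phi| < d],
    [set r | `|r - fine (E (tau_val phi))| < d]) => //=; split.
    by apply/nbhs_normP; exists d => //= v; rewrite /ball_/= distrC.
  by apply/nbhs_normP; exists d => //= v; rewrite /ball_/= distrC.
move=> v /= [v1 v2].
have Ev : dom E (tau_val v) by apply: set_mem; exact: (svalP (v : dom E)).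
have [w Uw] := HU _ Ev v1 v2.
by move=> /val_inj <-.
Qed.

(** [du] itself may fail to be Borel, so its integral is compared with that of
    [g] through the monotonicity of the integral, for which the two functions must be
    ordered everywhere; near [0] the integrability of [g] is used. *)
Lemma integral_ae_lt_pinfty (R : realType) (H : normedModType R) (du g : R -> H) (s : R) :
  {ae mu, forall t : R, 0 < t -> g t = du t} ->
  measurable_fun setT (fun t => `|g t|) ->
  (forall T : R, 0 < T -> mu.-integrable `]0, T[ (EFin \o (fun t => `|g t|))) ->
  0 < s -> (\int[mu]_(r in `]s, +oo[) `|g r|%:E < +oo)%E ->
  (\int[mu]_(t in `[0%R, +oo[) `|du t|%:E < +oo)%E.
Proof.
move=> [N [mN N0 gN]] mg ig s0 fin.
pose D : set (measurableTypeR R) := `[0, +oo[%classic.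
have mD : measurable D by exact: measurable_itv.
pose M : set (measurableTypeR R) := N `|` [set 0].
have mM : measurable M by apply: measurableU => //; exact: measurable_set1.
have M0 : mu M = 0.
  have : mu.-negligible M.
    apply: negligibleU; first by exists N; split.
    by exists [set 0]; split => //; exact: lebesgue_measure_set1.
  by move/(negligibleP _ mM).
(* The value [+oo] on the exceptional null set makes [G] dominate [|du|]
   everywhere without changing its integral. *)
pose G t := (if t \in M then +oo else `|g t|%:E)%E.
have mgE (A : set (measurableTypeR R)) : measurable_fun A (fun t => `|g t|%:E).
  by apply/measurable_EFinP; exact: measurable_funTS.
have mG : measurable_fun D G.
  apply: measurable_funTS; have -> : setT = M `|` ~` M by rewrite setUv.
  apply/measurable_funU => //; first exact: measurableC.
  split.
    apply: (eq_measurable_fun (cst (+oo%E : \bar R))) => [t tM|]; last exact: measurable_cst.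
    by rewrite /G tM.
  apply: (eq_measurable_fun (fun t => `|g t|%:E)) => [t|]; last exact: mgE.
  rewrite inE => nM.
  by rewrite /G memNset.
have G0 t : (0 <= G t)%E by rewrite /G; case: ifP; rewrite ?leey.
apply: (@le_lt_trans _ _ (\int[mu]_(t in D) G t)%E).
  apply: le_nonneg_integral => // t Dt; rewrite /G; case: ifPn => [_|]; first by rewrite leey.
  rewrite notin_setE => nM.
  have t0 : 0 < t.
    rewrite lt_neqAle eq_sym; move: Dt; rewrite /D/= in_itv/= andbT => ->; rewrite andbT.
    by apply/eqP => t0; apply: nM; right.
  have -> : du t = g t; last by [].
  apply: contrapT => dg; apply: nM; left; apply: gN => /= /(_ t0) E.
  by apply: dg.
have -> : (\int[mu]_(t in D) G t = \int[mu]_(t in D) `|g t|%:E)%E.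
  apply: ge0_ae_eq_integral => //.
  exists M; split => // t /= nE; apply: contrapT => nM; apply: nE => _.
  by rewrite /G memNset.
have -> : (\int[mu]_(t in D) `|g t|%:E = \int[mu]_(t in `]0%R, +oo[) `|g t|%:E)%E.
  by apply/esym; apply: integral_itv_obnd_cbnd; exact: mgE.
apply: (@le_lt_trans _ _ (\int[mu]_(t in `]0%R, (s + 1)%R[ `|` `]s, +oo[) `|g t|%:E)%E).
  apply: ge0_subset_integral => //; first exact: measurableU.
  move=> t /=; rewrite !in_itv/= !andbT => t0; have [ts|st] := leP t s; last by right.
  by left; rewrite t0/= (le_lt_trans ts)// ltrDl.
have i1 : (\int[mu]_(t in `]0%R, (s + 1)%R[) `|g t|%:E < +oo)%E.
  have /integrableP[_] := ig (s + 1) (addr_gt0 s0 ltr01).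
  by under eq_integral do rewrite /= normr_id.
apply: (le_lt_trans _ (lte_add_pinfty i1 fin)).
rewrite (_ : `]0%R, (s + 1)%R[ `|` `]s, +oo[ = `]0%R, (s + 1)%R[ `|` `[(s + 1)%R, +oo[)%classic; last first.
  apply/seteqP; split => t /=; rewrite !in_itv/= !andbT => -[].
  - by left.
  - move=> st; have [ts|ts] := ltP t (s + 1); last by right.
    by left; apply/andP; split => //; exact: lt_trans st.
  - by left.
  - by move=> st; right; lra.
rewrite ge0_integral_setU//=; last first.
  apply/disj_setPS => t /= []; rewrite !in_itv/= andbT => /andP[_ ts].
  by rewrite leNgt ts.
apply: leeD => //; apply: ge0_subset_integral => //.
by move=> t /=; rewrite !in_itv/= !andbT => st; lra.
Qed.

Theorem theorem3p3 (R : realType) (H : completeNormedModType R)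
  (dot : {dot H for idfun}) (dot_norm : forall v : H, dot v v = `|v| ^+ 2)
  (E : H -> \bar R) (E_proper : proper_functional E) (E_semiconvex : semiconvex E)
  (E_lsc : lower_semicontinuous E)
  (u du : R -> H) (u_sol : strong_solution dot E u du)
  (phi : tau E) (phi_omega : omega_limit u (tau_val phi))
  (U : set (tau E)) (U_nbhs : nbhs phi U)
  (E_KLS : KLS_inequality dot E (@tau_val R H E @` U)) :
  (\int[lebesgue_measure]_(t in `[0%R, +oo[) `|du t|%:E < +oo)%E /\
  tau_cvg u phi.
Proof.
have [[cu u_sob] ae_sub] := u_sol.
have [K K0 EK] := semiconvex_subgradient_le dot_norm E_proper E_semiconvex.
have [|g [ae_g g_du mg g_sep]] := @borel_representative R H du.
  by move=> T /u_sob[_ []].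
have g2 (T : R) : 0 < T -> (\int[mu]_(t in `]0%R, T[) (`|g t| ^+ 2)%:E < +oo)%E.
  move=> /u_sob[_ [_ du2] _]; apply: le_lt_trans du2.
  apply: le_nonneg_integral => t _; rewrite lee_fin ?exprn_ge0//.
  by have [->//|->] := g_du t; rewrite normr0 expr0n exprn_ge0.
have ucont (b : R) : {in `]0, b[, continuous u}.
  move=> t; rewrite in_itv/= => /andP[t0 _].
  have : {within `]0, +oo[, continuous u}.
    by apply: continuous_subspaceW cu => x /=; rewrite !in_itv/= !andbT => /ltW.
  rewrite continuous_open_subspace; last exact: rray_open.
  by apply; rewrite inE/= in_itv/= t0.
have ug w (s t : R) : 0 < s -> s < t ->
    dot (u t - u s) w = \int[mu]_(x in `]s, t]) dot (g x) w.
  move=> s0 st; have b0 : 0 < t + 1 by rewrite addr_gt0// (lt_trans s0).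
  have [_ _ wk] := u_sob _ b0; rewrite dotBl.
  have tt : t < t + 1 by rewrite ltrDl.
  pose D : set (measurableTypeR R) := `]0, (t + 1)[%classic.
  have mD : measurable D by exact: measurable_itv.
  have igw : mu.-integrable D (EFin \o (fun x => dot (g x) w)).
    have i0 := integrableZr mD `|w| (integrable_dist mg g2 0 b0).
    apply: (le_integrable mD _ _ i0).
      apply/measurable_EFinP; apply: measurable_funTS; exact: (measurable_dot dot_norm mg).
    move=> r _ /=; rewrite subr0 lee_fin normrM !normr_id.
    exact: norm_dot_le dot_norm _ _.
  have aew : {ae mu, forall r, 0 < r < t + 1 -> dot (g r) w = dot (du r) w}.
    move: ae_g; apply: filterS; first exact: (ae_filter_ringOfSetsType mu).
    by move=> x gx /andP[x0 _]; rewrite gx.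
  have bnd v : `|dot v w| <= `|w| * `|v| by rewrite mulrC; exact: norm_dot_le.
  exact: (@weak_derivative_functional _ _ 0 (t + 1) `|w| (fun v => dot v w) u du
    (fun x => dot (g x) w) (fun x y => dotDl dot x y w) (fun k x => dotZl dot k x w)
    bnd (ucont (t + 1)) wk igw aew s t s0 st tt).
have ig (T : R) : 0 < T -> mu.-integrable `]0, T[ (EFin \o (fun t => `|g t|)).
  move=> T0; have := integrable_dist mg g2 0 T0.
  by apply: eq_integrable => // t _ /=; rewrite subr0.
have mgn := measurable_norm mg.
have un (s t : R) : 0 < s -> s < t -> `|u t - u s| <= \int[mu]_(r in `]s, t]) `|g r|.
  move=> s0 st; have := norm_increment_le dot_norm mg g2 ug 0 s0 st.
  rewrite scaler0 subr0 => /le_trans; apply; rewrite le_eqVlt; apply/orP; left.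
  by apply/eqP; apply: eq_Rintegral => x _; rewrite subr0.
have good : {ae mu, forall t : R, 0 < t ->
    is_derive t 1 u (g t) /\ subgradient dot E (u t) (- g t)}.
  move: (ae_is_derive dot_norm mg g2 ug g_sep) ae_g ae_sub.
  apply: filterS3; first exact: (ae_filter_ringOfSetsType mu).
  by move=> t d1 d2 d3 t0; split; [exact: d1|rewrite d2//; exact: d3 (ltW t0)].
have [tn [tn0 tn_nd tn_oo u_phi]] := phi_omega.
have [ Theta [incr_Theta W_Theta KL]] := E_KLS.
have [delta delta0 HU] := (tau_nbhsP phi U).1 U_nbhs.
have Ephi : dom E (tau_val phi) by apply: set_mem; exact: (svalP (phi : dom E)).
have Theta_nd : {homo Theta : x y / x <= y}.
  by move=> x y; rewrite le_eqVlt => /orP[/eqP -> //|/incr_Theta/ltW].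
have KL' v : dom E v -> `|v - tau_val phi| < delta ->
    `|fine (E v) - fine (E (tau_val phi))| < delta ->
    ~ subgradient dot E v 0 -> (1 <= slope dot (er_map Theta \o E) v)%E.
  by move=> Ev v1 v2; apply: KL; exact: HU.
have [[s s0 fin] cvg_u cvg_E] := flow_converges dot_norm E_proper K0 EK mgn ig un good
  E_lsc Ephi tn_oo u_phi Theta_nd W_Theta.1 (W11loc_ae_is_derive W_Theta) delta0 KL'.
split; first exact: (integral_ae_lt_pinfty ae_g mgn ig s0 fin).
move=> V /tau_nbhsP[d d0 HV].
have d20 : 0 < d / 2 by rewrite divr_gt0.
near=> t; apply: HV.
- have t0 : 0 < t by near: t; apply: nbhs_pinfty_gt; exact: num_real.
  have := energy_fin_num dot_norm E_proper K0 EK mgn ig un good E_lsc t0.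
  by rewrite fin_numE /dom/= ltey => /andP[].
- by rewrite distrC; near: t; move/cvgrPdist_lt: cvg_u; apply.
- apply: (@le_lt_trans _ _ (d / 2)); last by rewrite ltr_pdivrMr// ltr_pMr// ltr1n.
  by near: t; exact: cvg_E.
Unshelve. all: by end_near. Qed.
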